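(* Let $n\geq 1$. There is a bijection $$\{\text{conjugation stable closed subspaces } Y \subset P^{n-1}_{\mathbb C}\}\longleftrightarrow \{\text{symmetric quantum subspaces } X \subset S^{n-1}_{\mathbb R,*}\}$$ given as follows: let $Y \subset P^{n-1}_{\mathbb C}$ be a conjugation stable closed subspace, and let $\mathcal J_Y \subset C(P^{n-1}_{\mathbb C})$ be the ideal of functions vanishing on $Y$; then the corresponding symmetric quantum subspace $X$ of $S^{n-1}_{\mathbb R,*}$ is defined by $C(X) = C( S^{n-1}_{\mathbb R,*})/ \langle\Phi(\mathcal J_Y)\rangle$.
   Context: All $C^*$-algebras and $C^*$-algebra maps are unital; ideals of $C^*$-algebras are closed and two-sided (the whole algebra is allowed, corresponding to the empty subspace). For $n\ge 1$, $C(S_{\mathbb R, *}^{n-1})$ (the algebra of the half-liberated real sphere) is the universal unital $C^*$-algebra generated by $v_1,\ldots,v_n$ subject to $\sum_{i=1}^n v_i^2=1$, $v_i^*=v_i$, and $v_iv_jv_k=v_kv_jv_i$ for all $1\leq i,j,k\leq n$. A quantum subspace $X\subset S^{n-1}_{\mathbb R,*}$ is a quotient $C(S^{n-1}_{\mathbb R,*})\to C(X)$ by an ideal $I$ (so quantum subspaces correspond to ideals). The sign automorphism $\nu$ of $C(S^{n-1}_{\mathbb R,*})$ is defined by $\nu(v_i)=-v_i$ for all $i$; it gives a $\mathbb Z_2$-grading $C(S^{n-1}_{\mathbb R,*})=C(S^{n-1}_{\mathbb R,*})_0\oplus C(S^{n-1}_{\mathbb R,*})_1$, where the degree $0$ and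 $1$ parts are the eigenspaces of $\nu$ for eigenvalues $1$ and $-1$. The quantum subspace $X$ is symmetric if its ideal $I$ is $\mathbb Z_2$-graded, i.e. $I=(I\cap C(S^{n-1}_{\mathbb R,*})_0)\oplus (I\cap C(S^{n-1}_{\mathbb R,*})_1)$, equivalently $\nu$ induces an automorphism of $C(S^{n-1}_{\mathbb R,*})/I$. $P^{n-1}_{\mathbb C}=S^{n-1}_{\mathbb C}/\mathbb T$ is the complex projective space, where $S^{n-1}_{\mathbb C}$ is the unit sphere of $\mathbb C^n$ with $\mathbb T$ acting by multiplication; $C(P^{n-1}_{\mathbb C})$ is identified with the $C^*$-subalgebra of $C(S^{n-1}_{\mathbb C})$ generated by the elements $z_iz_j^*$, where $z_1,\dots,z_n$ are the coordinate functions. ''Conjugation stable'' refers to the map of $P^{n-1}_{\mathbb C}$ induced by complex conjugation. $\Phi : C(P^{n-1}_{\mathbb C}) \to C(S^{n-1}_{\mathbb R,*})_0$ is the $*$-algebra isomorphism with $\Phi(z_iz_j^* )=v_iv_j$. $\langle S\rangle$ denotes the ideal of $C(S^{n-1}_{\mathbb R,*})$ generated by $S$. *)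

(* Defs.v *)
From HB Require Import structures.
From mathcomp Require Import all_boot all_order all_algebra.
From mathcomp Require Import all_classical all_reals all_analysis.
From mathcomp Require Import complex.

Set Implicit Arguments.
Unset Strict Implicit.
Unset Printing Implicit Defensive.

Import Order.TTheory GRing.Theory Num.Theory.
Import numFieldNormedType.Exports.

Local Open Scope classical_set_scope.
Local Open Scope ring_scope.

(* The topology of MathComp-Analysis on a numClosedFieldType C is attached to the
   projection Num.ClosedField.sort, so that it is not found on R[i] directly. *)
Definition complexF (R : realType) : numClosedFieldType := R[i]%C.

(* Below, the field C of scalars is an arbitrary numClosedFieldType.  As usual in
   MathComp-Analysis, norms on C-modules take their values in C (in its
   nonnegative, hence real, elements). *)

(** ** Unital star-algebras and C*-algebras *)

HB.mixin Record Algebra_isStarAlgebra (C : numClosedFieldType) A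
    of GRing.Algebra C A := {
  star : A -> A;
  starK : involutive star;
  starD : {morph star : x y / x + y};
  starM : forall x y, star (x * y) = star y * star x;
  starZ : forall (c : C) x, star (c *: x) = c^* *: star x
}.

#[short(type="starAlgType")]
HB.structure Definition StarAlgebra (C : numClosedFieldType) :=
  {A of Algebra_isStarAlgebra C A & GRing.Algebra C A}.

(* An HB structure joining GRing.Algebra and NormedModule would clash with
   Num.NumDomain, whose norm takes its values in the ring itself; hence this
   record, whose carrier gets both structures as canonical instances.  As with
   all MathComp algebras, the zero algebra is excluded.  This affects neither
   universal properties, since every star-algebra maps to the zero algebra, nor
   quotients, which are represented below by their kernels. *)
Structure cstarAlgType (C : numClosedFieldType) := CstarAlg {
  cstar_base : completeNormedModType C;
  cstar_one : cstar_base;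
  cstar_mul : cstar_base -> cstar_base -> cstar_base;
  cstar_star : cstar_base -> cstar_base;
  cstar_mulA : associative cstar_mul;
  cstar_mul1 : left_id cstar_one cstar_mul;
  cstar_mulr1 : right_id cstar_one cstar_mul;
  cstar_mulDl : left_distributive cstar_mul +%R;
  cstar_mulDr : right_distributive cstar_mul +%R;
  cstar_one_neq0 : cstar_one != 0;
  cstar_scaleAl : forall (c : C) x y,
    c *: cstar_mul x y = cstar_mul (c *: x) y;
  cstar_scaleAr : forall (c : C) x y,
    c *: cstar_mul x y = cstar_mul x (c *: y);
  cstar_starK : involutive cstar_star;
  cstar_starD : {morph cstar_star : x y / x + y};
  cstar_starM : forall x y,
    cstar_star (cstar_mul x y) = cstar_mul (cstar_star y) (cstar_star x);
  cstar_starZ : forall (c : C) x,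
    cstar_star (c *: x) = c^* *: cstar_star x;
  cstar_normM : forall x y, `|cstar_mul x y| <= `|x| * `|y|;
  cstar_norm : forall x, `|cstar_mul (cstar_star x) x| = `|x| ^+ 2
}.

Definition cstar_sort (C : numClosedFieldType) (A : cstarAlgType C) : Type :=
  cstar_base A.
Coercion cstar_sort : cstarAlgType >-> Sortclass.

Section CstarInstances.
Variables (C : numClosedFieldType) (A : cstarAlgType C).
HB.instance Definition _ := CompleteNormedModule.copy A (cstar_base A).
HB.instance Definition _ := GRing.Zmodule_isNzRing.Build A
  (@cstar_mulA C A) (@cstar_mul1 C A) (@cstar_mulr1 C A)
  (@cstar_mulDl C A) (@cstar_mulDr C A) (@cstar_one_neq0 C A).
HB.instance Definition _ :=
  GRing.Lmodule_isLalgebra.Build C A (@cstar_scaleAl C A).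
HB.instance Definition _ :=
  GRing.Lalgebra_isAlgebra.Build C A (@cstar_scaleAr C A).
HB.instance Definition _ := Algebra_isStarAlgebra.Build C A
  (@cstar_starK C A) (@cstar_starD C A) (@cstar_starM C A) (@cstar_starZ C A).

Lemma cstar_ler_normM (x y : A) : `|x * y| <= `|x| * `|y|.
Proof. exact: cstar_normM. Qed.

Lemma cstar_normE (x : A) : `|star x * x| = `|x| ^+ 2.
Proof. exact: cstar_norm. Qed.
End CstarInstances.

Definition star_preserving (C : numClosedFieldType) (A B : starAlgType C)
  (f : A -> B) := forall x, f (star x) = star (f x).

Section CstarAlgebras.
Variables (C : numClosedFieldType) (A : cstarAlgType C).

Definition closed_star_subalgebra (B : set A) :=
  [/\ B 1,
      (forall (c : C) x y, B x -> B y -> B (c *: x + y)),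
      (forall x y, B x -> B y -> B (x * y)),
      (forall x, B x -> B (star x))
    & closed B].

Definition closed_ideal (I : set A) :=
  [/\ I 0,
      (forall x y, I x -> I y -> I (x + y)),
      (forall a x, I x -> I (a * x)),
      (forall a x, I x -> I (x * a))
    & closed I].

Definition ideal_gen (S : set A) : set A := smallest closed_ideal S.

End CstarAlgebras.

(** ** The half-liberated real sphere *)

Section HalfLiberatedSphere.
Variables (C : numClosedFieldType) (n : nat).

Definition half_liberated_relations (B : cstarAlgType C) (w : 'I_n -> B) :=
  [/\ \sum_i w i ^+ 2 = 1,
      (forall i, star (w i) = w i)
    & (forall i j k, w i * w j * w k = w k * w j * w i)].

(* (A, v) is the universal unital C*-algebra generated by v_1, ..., v_n subject
   to the above relations. *)
Definition is_half_liberated_sphere (A : cstarAlgType C) (v : 'I_n -> A) :=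
  [/\ half_liberated_relations v,
      smallest (@closed_star_subalgebra C A) (range v) = setT
    & forall (B : cstarAlgType C) (w : 'I_n -> B), half_liberated_relations w ->
        exists f : {lrmorphism A -> B},
          star_preserving f /\ forall i, f (v i) = w i].

Lemma starN (A : starAlgType C) (x : A) : star (- x) = - star x.
Proof. by rewrite -scaleN1r starZ rmorphN1 scaleN1r. Qed.

Lemma half_liberated_relationsN (A : cstarAlgType C) (v : 'I_n -> A) :
  half_liberated_relations v -> half_liberated_relations (fun i => - v i).
Proof.
case=> sum1 sa hl; split=> [|i|i j k].
- by rewrite -[RHS]sum1; apply: eq_bigr => i _; rewrite sqrrN.
- by rewrite starN sa.
- by rewrite !mulrNN !mulrN hl.
Qed.

Section Sign.
Variables (A : cstarAlgType C) (v : 'I_n -> A).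
Hypothesis Av : is_half_liberated_sphere v.

Lemma sign_ex : exists f : {lrmorphism A -> A},
  star_preserving f /\ forall i, f (v i) = - v i.
Proof.
by case: Av => relv _ univ; apply: univ; exact: half_liberated_relationsN.
Qed.

(* The sign automorphism; it is unique since the v_i generate A. *)
Definition sign : {lrmorphism A -> A} := projT1 (cid sign_ex).

Lemma sign_star : star_preserving sign.
Proof. by rewrite /sign; case: cid => f []. Qed.

Lemma sign_gen i : sign (v i) = - v i.
Proof. by rewrite /sign; case: cid => f []. Qed.

Definition even_part : set A := [set x | sign x = x].
Definition odd_part : set A := [set x | sign x = - x].

Definition graded (I : set A) :=
  I = [set x + y | x in I `&` even_part & y in I `&` odd_part] /\
  (I `&` even_part) `&` (I `&` odd_part) = [set 0].

End Sign.
End HalfLiberatedSphere.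

(** ** The star-algebra of continuous functions on a space *)

Section ContinuousFunctions.
Variables (C : numClosedFieldType) (X : ptopologicalType).
Notation CX := (continuousType X C).
Implicit Types f g h : CX.

Lemma conjC_continuous : continuous (Num.conj : C -> C).
Proof.
move=> x; apply/(@cvgrPdist_lt C C C (nbhs x) (nbhs_filter x)) => e e0.
have := @cvgr_dist_lt C C C (nbhs x) (nbhs_filter x) id x (@cvg_id _ _) e e0.
by apply: filterS => y xy; rewrite -rmorphB norm_conjC.
Qed.

Let cts f : continuous f := @cts_fun _ _ f.

Let cst_cts (c : C) : continuous (fun _ : X => c).
Proof. exact: cst_continuous. Qed.
Let add_cts f g : continuous (fun x => f x + g x).
Proof. by move=> x; apply: cvgD; exact: cts. Qed.
Let opp_cts f : continuous (fun x => - f x).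
Proof. by move=> x; apply: cvgN; exact: cts. Qed.
Let mul_cts f g : continuous (fun x => f x * g x).
Proof. by move=> x; apply: cvgM; exact: cts. Qed.
Let scale_cts c f : continuous (fun x => c * f x).
Proof. by move=> x; apply: cvgM; [exact: cvg_cst|exact: cts]. Qed.
Let conj_cts f : continuous (fun x => (f x)^*).
Proof. by move=> x; apply: continuous_comp; [exact: cts|exact: conjC_continuous]. Qed.

Definition cfun_cst c : CX := mkcts (@cst_cts c).
Definition cfun_add f g : CX := mkcts (@add_cts f g).
Definition cfun_opp f : CX := mkcts (@opp_cts f).
Definition cfun_mul f g : CX := mkcts (@mul_cts f g).
Definition cfun_scale c f : CX := mkcts (@scale_cts c f).
Definition cfun_conj f : CX := mkcts (@conj_cts f).

Let addA : associative cfun_add.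
Proof. by move=> f g h; apply/continuousEP => x /=; exact: addrA. Qed.
Let addC : commutative cfun_add.
Proof. by move=> f g; apply/continuousEP => x /=; exact: addrC. Qed.
Let add0 : left_id (cfun_cst 0) cfun_add.
Proof. by move=> f; apply/continuousEP => x /=; exact: add0r. Qed.
Let addN : left_inverse (cfun_cst 0) cfun_opp cfun_add.
Proof. by move=> f; apply/continuousEP => x /=; exact: addNr. Qed.
HB.instance Definition _ := GRing.isZmodule.Build CX addA addC add0 addN.

Let mulA : associative cfun_mul.
Proof. by move=> f g h; apply/continuousEP => x /=; exact: mulrA. Qed.
Let mulC : commutative cfun_mul.
Proof. by move=> f g; apply/continuousEP => x /=; exact: mulrC. Qed.
Let mul1 : left_id (cfun_cst 1) cfun_mul.
Proof. by move=> f; apply/continuousEP => x /=; exact: mul1r. Qed.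
Let mulD : left_distributive cfun_mul +%R.
Proof. by move=> f g h; apply/continuousEP => x /=; exact: mulrDl. Qed.
Let one_neq0 : cfun_cst 1 != 0.
Proof.
by apply/eqP => /continuousEP /(_ point) /= /eqP; rewrite oner_eq0.
Qed.
HB.instance Definition _ :=
  GRing.Zmodule_isComNzRing.Build CX mulA mulC mul1 mulD one_neq0.

Let scaleA a b f : cfun_scale a (cfun_scale b f) = cfun_scale (a * b) f.
Proof. by apply/continuousEP => x /=; exact: mulrA. Qed.
Let scale1 : left_id 1 cfun_scale.
Proof. by move=> f; apply/continuousEP => x /=; exact: mul1r. Qed.
Let scaleDr : right_distributive cfun_scale +%R.
Proof. by move=> a f g; apply/continuousEP => x /=; exact: mulrDr. Qed.
Let scaleDl f : {morph cfun_scale^~ f : a b / a + b}.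
Proof. by move=> a b; apply/continuousEP => x /=; exact: mulrDl. Qed.
HB.instance Definition _ :=
  GRing.Zmodule_isLmodule.Build C CX scaleA scale1 scaleDr scaleDl.

Let scaleAl (a : C) f g : a *: (f * g) = (a *: f) * g.
Proof. by apply/continuousEP => x /=; exact: mulrA. Qed.
HB.instance Definition _ := GRing.Lmodule_isLalgebra.Build C CX scaleAl.
HB.instance Definition _ := GRing.Lalgebra_isComAlgebra.Build C CX.

Let conjfK : involutive cfun_conj.
Proof. by move=> f; apply/continuousEP => x /=; exact: conjCK. Qed.
Let conjfD : {morph cfun_conj : f g / f + g}.
Proof. by move=> f g; apply/continuousEP => x /=; exact: rmorphD. Qed.
Let conjfM f g : cfun_conj (f * g) = cfun_conj g * cfun_conj f.
Proof. by rewrite mulrC; apply/continuousEP => x /=; exact: rmorphM. Qed.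
Let conjfZ (c : C) f : cfun_conj (c *: f) = c^* *: cfun_conj f.
Proof. by apply/continuousEP => x /=; exact: rmorphM. Qed.
HB.instance Definition _ :=
  Algebra_isStarAlgebra.Build C CX conjfK conjfD conjfM conjfZ.

Lemma cfunDE f g x : (f + g) x = f x + g x. Proof. by []. Qed.
Lemma cfunME f g x : (f * g) x = f x * g x. Proof. by []. Qed.
Lemma cfunZE (c : C) f x : (c *: f) x = c * f x. Proof. by []. Qed.
Lemma cfun1E x : (1 : CX) x = 1. Proof. by []. Qed.
Lemma cfun_starE f x : (star f) x = (f x)^*. Proof. by []. Qed.

Definition vanishing_ideal (Y : set X) : set CX :=
  [set f | forall y, Y y -> f y = 0].

End ContinuousFunctions.

(** ** Complex projective space *)

Section ProjectiveSpace.
Variables (C : numClosedFieldType) (n : nat).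
Local Open Scope quotient_scope.

Definition complex_sphere : set 'rV[C]_n :=
  [set x | \sum_i `|x 0 i| ^+ 2 = 1].

Notation S := (set_type complex_sphere).

Lemma complex_sphereP (x : S) : \sum_i `|\val x 0 i| ^+ 2 = 1.
Proof. exact: set_valP x. Qed.

(* Same orbit under the action of the circle group by multiplication. *)
Definition phase_rel : rel S :=
  fun x y => `[< exists2 t : C, `|t| = 1 & \val y = t *: \val x >].

Lemma phase_refl : reflexive phase_rel.
Proof. by move=> x; apply/asboolP; exists 1; rewrite ?normr1 ?scale1r. Qed.

Lemma phase_symL x y : phase_rel x y -> phase_rel y x.
Proof.
move=> /asboolP[t t1 yE]; apply/asboolP; exists t^-1; first by rewrite normfV t1 invr1.
by rewrite yE scalerA mulVf ?scale1r// -normr_gt0 t1.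
Qed.

Lemma phase_sym : symmetric phase_rel.
Proof. by move=> x y; apply/idP/idP; exact: phase_symL. Qed.

Lemma phase_trans : transitive phase_rel.
Proof.
move=> y x z /asboolP[s s1 yE] /asboolP[t t1 zE]; apply/asboolP.
by exists (t * s); rewrite ?normrM ?s1 ?t1 ?mulr1// zE yE scalerA.
Qed.

Canonical phase_equiv := EquivRel phase_rel phase_refl phase_sym phase_trans.

Definition cproj : Type := quotient_topology {eq_quot phase_equiv}.
HB.instance Definition _ := Topological.on cproj.
HB.instance Definition _ := Quotient.on cproj.

Lemma cprojP (x y : S) : reflect (\pi_cproj x = \pi_cproj y) (phase_rel x y).
Proof. exact: (@eqmodP _ phase_equiv x y). Qed.

Lemma conj_sphere_subproof (x : S) : complex_sphere (map_mx Num.conj (\val x)).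
Proof.
rewrite /complex_sphere/= -[RHS](complex_sphereP x).
by apply: eq_bigr => i _; rewrite mxE norm_conjC.
Qed.

Definition conj_sphere (x : S) : S := SigSub (mem_set (conj_sphere_subproof x)).

Definition cproj_conj (p : cproj) : cproj := \pi_cproj (conj_sphere (repr p)).

Lemma cproj_conjE (x : S) : cproj_conj (\pi_cproj x) = \pi_cproj (conj_sphere x).
Proof.
apply/cprojP; have /cprojP/asboolP[t t1 xE] : \pi_cproj (repr (\pi_cproj x)) = \pi_cproj x.
  exact: reprK.
apply/asboolP; exists t^*; first by rewrite norm_conjC.
by rewrite /= xE; apply/rowP => i; rewrite !mxE rmorphM.
Qed.

Definition conj_stable (Y : set cproj) := cproj_conj @` Y `<=` Y.

(* The function z_i z_j^* on the sphere. *)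
Definition zz_sphere (i j : 'I_n) (x : S) : C := \val x 0 i * (\val x 0 j)^*.

Lemma zz_sphere_continuous i j : continuous (zz_sphere i j).
Proof.
have cval k : continuous (fun x : S => \val x 0 k).
  move=> x; apply: (@continuous_comp _ _ _ (set_val : S -> _) (fun M : 'rV[C]_n => M 0 k)).
    exact: initial_continuous.
  exact: coord_continuous.
move=> x; apply: (@cvgM _ _ (nbhs x) (nbhs_filter x)); first exact: cval.
apply: (@continuous_comp _ _ _ (fun x : S => \val x 0 j) Num.conj).
  exact: cval.
exact: conjC_continuous.
Qed.

Lemma zz_sphere_phase i j x y : phase_rel x y -> zz_sphere i j x = zz_sphere i j y.
Proof.
move=> /asboolP[t t1 yE]; rewrite /zz_sphere yE !mxE rmorphM mulrACA.
by rewrite -normCK t1 expr1n mul1r.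
Qed.

Lemma zz_cproj_continuous i j : continuous (zz_sphere i j \o repr : cproj -> C).
Proof.
apply: repr_comp_continuous; first exact: zz_sphere_continuous.
by move=> a b /eqP/cprojP/zz_sphere_phase ->.
Qed.

(* The function z_i z_j^* on the projective space. *)
Definition zz (i j : 'I_n) : continuousType cproj C :=
  mkcts (@zz_cproj_continuous i j).

Lemma zzE i j (x : S) : zz i j (\pi_cproj x) = \val x 0 i * (\val x 0 j)^*.
Proof. by apply: zz_sphere_phase; apply/cprojP; exact: reprK. Qed.

End ProjectiveSpace.
Arguments zz {C n} i j.

Section PointedProjectiveSpace.
Variables (C : numClosedFieldType) (n : nat).
Local Open Scope quotient_scope.

(* The complex projective space of dimension n is nonempty, so that the algebra
   of continuous functions on it is a (nonzero) ring. *)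
Lemma sphere_point_subproof : complex_sphere (delta_mx 0 0 : 'rV[C]_n.+1).
Proof.
rewrite /complex_sphere/= (bigD1 ord0)//= !mxE !eqxx normr1 expr1n big1 ?addr0//.
by move=> i i0; rewrite mxE (negPf i0) andbF normr0 expr0n.
Qed.

HB.instance Definition _ := isPointed.Build (cproj C n.+1)
  (\pi_(cproj C n.+1) (SigSub (mem_set sphere_point_subproof))).

End PointedProjectiveSpace.

(** ** The isomorphism between C(P^{n-1}) and the even part *)

Definition is_even_part_iso (C : numClosedFieldType) (n : nat)
    (A : cstarAlgType C) (v : 'I_n.+1 -> A) (Av : is_half_liberated_sphere v)
    (Phi : {lrmorphism continuousType (cproj C n.+1) C -> A}) :=
  [/\ star_preserving Phi,
      set_bij setT (even_part Av) Phi
    & forall i j, Phi (zz i j) = v i * v j].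

(* Main.v *)
(* Conjugating by a generator interacts simply with the even part: the relation
   v_i v_j v_k = v_k v_j v_i says that v_i a = a^c v_i when a = v_j v_k, where ^c
   corresponds to complex conjugation on the projective space.  As star-morphisms
   are continuous, this holds for all even a, since the v_j v_k generate the even
   part.  Writing an odd element y as the sum of the v_i (v_i y), one finds that
   a graded closed ideal is determined by its even part, and that the closed
   ideals of the even part arising in this way are those stable under conjugation.
   The latter are the ideals of functions vanishing on a conjugation stable closed
   set, by compactness of the projective space.

   Continuity of star-morphisms and of Phi^-1 is obtained without spectral theory:
   a self-adjoint x of norm at most 1/2 satisfies x^2 + h^2 = 1 with h self-adjoint
   and commuting with x, this relation is preserved by morphisms, and it implies
   |x| <= 1 because x is the real part of x + i h, where |x + i h|^2 = 1. *)
Require Import Defs.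
From HB Require Import structures.
From mathcomp Require Import all_boot all_order all_algebra.
From mathcomp Require Import all_classical all_reals all_analysis.
From mathcomp Require Import complex.

Set Implicit Arguments.
Unset Strict Implicit.
Unset Printing Implicit Defensive.

Import Order.TTheory GRing.Theory Num.Theory.
Import numFieldNormedType.Exports.

Local Open Scope classical_set_scope.
Local Open Scope ring_scope.

(** * Limits in the complex scalars and in normed modules *)

Section ComplexScalars.
Variable R : realType.
Notation C := (complexF R).

(** A positive element of [C] has zero imaginary part, so the geometric decay in [R] applies. This
    makes the iterates in [sqrt_one_sub] a Cauchy sequence. *)
Lemma half_exp_lt (e : C) : 0 < e -> exists k, 2^-1 ^+ k < e.
Proof.
case: e => e1 e2; rewrite ltcE/= => /andP[/eqP-> e0].
have := @cvg_expr R 2^-1; rewrite ger0_norm ?invr_ge0// invf_lt1// ltr1n => /(_ isT).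
move=> /cvgrPdist_lt /(_ _ e0)[k _ /(_ k (leqnn k))]; rewrite sub0r normrN.
rewrite ger0_norm ?exprn_ge0 ?invr_ge0// => ke; exists k.
rewrite (_ : 2^-1 ^+ k = real_complex R (2^-1 ^+ k)) ?ltcR//.
by rewrite rmorphXn/= fmorphV rmorph_nat.
Qed.

End ComplexScalars.

Section NormedModules.
Variable C : numFieldType.

Lemma closedP_dist (V : normedModType C) (B : set V) :
  closed B <->
  forall x, (forall e : C, 0 < e -> exists2 y, B y & `|x - y| < e) -> B x.
Proof.
split=> [cB x xB|xB x].
  apply: cB => N /nbhs_ballP[e /= e0 eN].
  by have [y By xy] := xB e e0; exists y; split=> //; apply: eN; rewrite -ball_normE.
move=> clx; apply: xB => e e0.
have [y [By]] := clx _ (nbhsx_ballx x e e0).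
by rewrite -ball_normE/= => ?; exists y.
Qed.

Lemma bounded_additive_continuous (V W : normedModType C) (f : V -> W) (K : C) :
  0 <= K -> {morph f : x y / x - y} -> (forall x, `|f x| <= K * `|x|) ->
  continuous f.
Proof.
move=> K0 fB fK x; have K1 : 0 < K + 1 by rewrite ltr_wpDl.
apply/cvgrPdist_lt => e e0.
have e1 : 0 < e / (K + 1) by rewrite divr_gt0.
have /cvgrPdist_lt/(_ _ e1) : y @[y --> x] --> x by exact: cvg_id.
apply: filterS => y xy.
rewrite -fB (le_lt_trans (fK _))//.
rewrite (@le_lt_trans _ _ ((K + 1) * `|x - y|)) ?ler_wpM2r ?lerDl//.
by rewrite mulrC -ltr_pdivlMr.
Qed.

End NormedModules.

(** * Norm estimates in a C*-algebra *)

Section CstarAlgebra.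
Variable C : numClosedFieldType.
Variable A : cstarAlgType C.
Implicit Types x y : A.

Lemma star0 (B : starAlgType C) : star (0 : B) = 0.
Proof. by apply: (@addIr _ (star (0 : B))); rewrite -starD !add0r. Qed.

Lemma starB (B : starAlgType C) : {morph @star C B : x y / x - y}.
Proof. by move=> x y; rewrite starD starN. Qed.

Lemma star1 (B : starAlgType C) : star (1 : B) = 1.
Proof. by rewrite -[LHS]mulr1 -{2}(starK (1 : B)) -starM mulr1 starK. Qed.

(** The C*-identity and submultiplicativity bound [|y|^2] by [|star y| |y|]; cancel [|y|], then use
    the result for both [x] and [star x]. *)
Lemma norm_star x : `|star x| = `|x|.
Proof.
suff le y : `|y| <= `|star y| by apply/le_anti; rewrite le -{2}(starK x) le.
have [->|y0] := eqVneq y 0; first by rewrite normr0.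
by rewrite -(@ler_pM2r _ `|y|) ?normr_gt0// -expr2 -cstar_normE cstar_ler_normM.
Qed.

Lemma cstar_norm1 : `|1 : A| = 1.
Proof.
apply: (@mulfI _ `|1 : A|); first by rewrite normr_eq0 oner_neq0.
by rewrite -expr2 -cstar_normE star1 !mulr1.
Qed.

Lemma norm_sa_sqr x : star x = x -> `|x * x| = `|x| ^+ 2.
Proof. by move=> xsa; rewrite -cstar_normE xsa. Qed.

Lemma continuous_star : continuous (star : A -> A).
Proof.
apply: (@bounded_additive_continuous _ A A _ 1) => //; first exact: starB.
by move=> x; rewrite norm_star mul1r.
Qed.

Lemma continuous_mull y : continuous (fun x => y * x).
Proof.
apply: (@bounded_additive_continuous _ A A _ `|y|) => //; first exact: mulrBr.
by move=> x; exact: cstar_ler_normM.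
Qed.

Lemma continuous_mulr y : continuous (fun x => x * y).
Proof.
apply: (@bounded_additive_continuous _ A A _ `|y|) => //; first exact: mulrBl.
by move=> x; rewrite mulrC cstar_ler_normM.
Qed.

(* [x + i y] is normal with real part [x], and its modulus squared is [x^2 + y^2]. *)
Lemma norm_sqr_le_add x y : star x = x -> star y = y -> x * y = y * x ->
  `|x| ^+ 2 <= `|x * x + y * y|.
Proof.
move=> xsa ysa xy; pose z := x + 'i *: y.
have zE : star z = x - 'i *: y by rewrite /z starD starZ conjCi scaleNr xsa ysa.
have -> : x * x + y * y = star z * z.
  rewrite zE /z mulrDr !mulrBl -!scalerAl -!scalerAr scalerA -(expr2 'i) sqrCi xy.
  by rewrite scaleN1r opprK addrA subrK.
rewrite cstar_normE lerXn2r ?nnegrE//.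
have -> : x = 2^-1 *: (z + star z).
  rewrite zE /z addrACA subrr addr0 -mulr2n -[x *+ 2]scaler_nat scalerA.
  by rewrite mulVf ?pnatr_eq0 ?scale1r.
rewrite normrZ ger0_norm ?invr_ge0//.
by rewrite ler_pdivrMl// (le_trans (ler_normD _ _))// norm_star mulr_natl mulr2n.
Qed.

End CstarAlgebra.

(** * Square roots near the identity *)

Section SquareRoot.
Variables (R : realType) (A : cstarAlgType (complexF R)).
Implicit Types x s t : A.

(* [1 - s] is a square root of [1 - x]; it is obtained by iterating the
   contraction [s |-> (x + s^2) / 2], which lets [s] inherit closed properties. *)
Lemma sqrt_one_sub x (Q : set A) : `|x| <= 4^-1 -> closed Q -> Q 0 ->
    (forall s, Q s -> Q (2^-1 *: (x + s * s))) ->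
  exists2 s, Q s & (1 - s) * (1 - s) = 1 - x.
Proof.
move=> xle cQ Q0 QT; pose T s := 2^-1 *: (x + s * s); pose u k := iter k T 0.
have T_ball s : `|s| <= 2^-1 -> `|T s| <= 2^-1.
  move=> s2; rewrite /T normrZ ger0_norm ?invr_ge0// ler_piMr ?invr_ge0//.
  have ss : `|s * s| <= 4^-1.
    rewrite (le_trans (cstar_ler_normM _ _))//.
    rewrite (_ : 4^-1 = 2^-1 * 2^-1) ?ler_pM//.
    by rewrite -invfM -natrM.
  rewrite (le_trans (ler_normD _ _))// (le_trans (lerD xle ss))//.
  rewrite -mulr2n -[_ *+ 2]mulr_natl ler_pdivrMr// mul1r.
  by rewrite ler_nat.
have T_lip s t : `|s| <= 2^-1 -> `|t| <= 2^-1 -> `|T s - T t| <= 2^-1 * `|s - t|.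
  move=> s2 t2; rewrite /T -scalerBr normrZ ger0_norm ?invr_ge0//.
  rewrite ler_wpM2l ?invr_ge0// opprD addrACA subrr add0r.
  (* This form of [s * s - t * t] does not need [s] and [t] to commute. The Lipschitz constant is
     then [(|s| + |t|) / 2], at most 1/2 on the ball. *)
  rewrite (_ : _ - _ = s * (s - t) + (s - t) * t); last first.
    by rewrite mulrBr mulrBl addrA subrK.
  rewrite (le_trans (ler_normD _ _))//.
  rewrite (le_trans (lerD (cstar_ler_normM _ _) (cstar_ler_normM _ _)))//.
  rewrite [ `|s - t| * _]mulrC -mulrDl ler_piMl//.
  by rewrite (le_trans (lerD s2 t2))// -mulr2n -[_ *+ 2]mulr_natl mulfV.
have iter_ball s k : `|s| <= 2^-1 -> `|iter k T s| <= 2^-1.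
  by move=> s2; elim: k => //= k; exact: T_ball.
have u_ball k : `|u k| <= 2^-1 by apply: iter_ball; rewrite normr0 invr_ge0.
have u_cauchy k m : `|u k - u (k + m)| <= 2^-1 ^+ k.
  rewrite {2}/u iterD -/(u m).
  (* Apply the contraction [k] times to the pair [0], [u m], whose distance is at most 1/2. *)
  have : `|u k - iter k T (u m)| <= 2^-1 ^+ k * 2^-1.
    elim: k => [|k IH]; first by rewrite expr0 mul1r sub0r normrN u_ball.
    rewrite exprS -mulrA (le_trans (T_lip _ _ _ _)) ?ler_wpM2l ?invr_ge0//;
      by rewrite iter_ball ?normr0 ?invr_ge0 ?u_ball.
  move/le_trans; apply; rewrite ler_piMr ?exprn_ge0 ?invr_ge0//.
  by rewrite invf_le1// ler1n.
have Qu k : Q (u k) by elim: k => //= k; exact: QT.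
have /cvg_ex[/= s us] : cvgn u.
  apply/cauchy_cvgP; apply: cauchy_exP => e e0.
  have [k ke] := half_exp_lt e0; exists (u k).
  exists k => // m /= km; rewrite -ball_normE/= -(subnKC km).
  exact: le_lt_trans (u_cauchy _ _) ke.
have /cvgrPdist_le us_le := us.
have sE : s = T s.
  have s2 : `|s| <= 2^-1.
    apply/ler_addgt0Pr => e e0.
    have [k _ /(_ k (leqnn k)) /= sk] := us_le _ e0.
    rewrite -(subrK (u k) s) (le_trans (ler_normD _ _))// addrC lerD//.
  apply/eqP; rewrite -subr_eq0 -normr_le0; apply/ler_addgt0Pr => e e0; rewrite add0r.
  have e2 : 0 < e / 2 by rewrite divr_gt0.
  have [k _ sk] := us_le _ e2.
  have /= sk0 := sk _ (leqnn k); have /= sk1 := sk _ (leqnSn k).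
  rewrite (le_trans (ler_distD (T (u k)) _ _))//.
  rewrite [e]splitr lerD// (le_trans (T_lip _ _ _ _))//.
  by rewrite distrC (le_trans _ sk0)// ler_piMl// invf_le1// ler1n.
exists s; first by apply: closed_cvg us => //; exact: nearW.
(* The fixed point equation, which is [(1 - s)^2 = 1 - x] after completing the square. *)
have : s *+ 2 = x + s * s.
  by rewrite [in LHS]sE -[_ *+ 2]scaler_nat scalerA mulfV ?scale1r// pnatr_eq0.
rewrite mulrBl mul1r mulrBr mulr1 mulr2n => sE2.
have -> : x = s + s - s * s by rewrite sE2 addrK.
by rewrite !opprB -!addrA opprD [- s + _]addrCA.
Qed.

End SquareRoot.

(** * Automatic continuity of star-morphisms *)

Lemma closed_equalizer (C : numFieldType) (V : normedModType C) (W : normedModType C)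
  (f g : V -> W) : continuous f -> continuous g -> closed [set x | f x = g x].
Proof.
move=> cf cg; rewrite (_ : mkset _ = (fun x => f x - g x) @^-1` [set 0]).
  apply: closed_comp; last first.
    exact: accessible_closed_set1 (hausdorff_accessible (@norm_hausdorff _ W)) _.
  by move=> x _; apply: cvgB; [exact: cf|exact: cg].
by apply/seteqP; split=> x /= => [->|/eqP]; rewrite ?subrr ?subr_eq0// => /eqP.
Qed.

Section StarMorphism.
Variables (R : realType) (A B : cstarAlgType (complexF R)).
Variables (f : {lrmorphism A -> B}) (fstar : star_preserving f).

Lemma star_morphism_sa_le (y : A) : star y = y -> `|f y| <= 2 * `|y|.
Proof.
move=> ysa; have [->|y0] := eqVneq y 0; first by rewrite rmorph0 !normr0 mulr0.
have ny0 : 0 < 2 * `|y| by rewrite mulr_gt0 ?normr_gt0.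
(* Scaling to norm 1/2 gives [z * z] the norm 1/4 allowed by [sqrt_one_sub]; this is the source of
   the factor 2. *)
pose c := (2 * `|y|)^-1.
have c0 : 0 < c by rewrite invr_gt0.
have cconj : c^* = c by apply/CrealP/ger0_real/ltW.
have [z zE] : exists z, z = c *: y by exists (c *: y).
have zsa : star z = z by rewrite zE starZ cconj ysa.
have nz : `|z| = 2^-1.
  by rewrite zE normrZ gtr0_norm// /c invfM mulfVK// normr_eq0.
(* [Q] keeps [s] self-adjoint and commuting with [z]; both properties pass to the images under [f],
   where [norm_sqr_le_add] needs them. *)
pose Q := [set s : A | star s = s] `&` [set s | z * s = s * z].
have [s [/= ssa zs] ss] : exists2 s, Q s & (1 - s) * (1 - s) = 1 - z * z.
  apply: sqrt_one_sub.
  - by rewrite norm_sa_sqr// nz expr2 -invfM -natrM.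
  - by apply: closedI; apply: closed_equalizer;
      [exact: continuous_star|by move=> ?; exact: cvg_id
      |exact: continuous_mull|exact: continuous_mulr].
  - by split; rewrite /= ?star0 ?mulr0 ?mul0r.
  - move=> s [/= ssa zs]; split=> /=.
      by rewrite starZ starD !starM zsa ssa fmorphV rmorph_nat.
    rewrite -scalerAl -scalerAr mulrDl mulrDr; congr (_ *: (_ + _)); first exact: mulrA.
    by rewrite mulrA zs -mulrA zs mulrA.
have h2 : f z * f z + f (1 - s) * f (1 - s) = 1.
  by rewrite -!rmorphM -rmorphD ss addrC subrK rmorph1.
have : `|f z| ^+ 2 <= 1.
  rewrite -(cstar_norm1 B) -h2; apply: norm_sqr_le_add.
  - by rewrite -fstar zsa.
  - by rewrite -fstar starB star1 ssa.
  - by rewrite -!rmorphM mulrBr mulrBl mulr1 mul1r zs.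
rewrite zE linearZ_LR normrZ gtr0_norm// expr_le1 ?mulr_ge0// ?(ltW c0)//.
by rewrite ler_pdivrMl// mulr1.
Qed.

(** The C*-identity reduces to the self-adjoint element [star x * x], giving [|f x|^2 <= 2 |x|^2],
    which is at most [(2 |x|)^2]. *)
Lemma star_morphism_le (x : A) : `|f x| <= 2 * `|x|.
Proof.
rewrite -(@ler_pXn2r _ 2) ?nnegrE ?mulr_ge0//.
rewrite -cstar_normE -fstar -rmorphM (le_trans (star_morphism_sa_le _))//.
  by rewrite starM starK.
by rewrite cstar_normE exprMn ler_wpM2r ?exprn_ge0// expr2 ler_peMl// ler1n.
Qed.

Lemma star_morphism_continuous : continuous f.
Proof.
apply: (@bounded_additive_continuous _ A B _ 2) => //; first exact: rmorphB.
exact: star_morphism_le.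
Qed.

End StarMorphism.

(** * Comparison of the sup norm with the norm of the image in a C*-algebra *)

Lemma continuous_sqrtC (C : numClosedFieldType) (X : topologicalType) (f : X -> C) :
  (forall x, 0 <= f x) -> continuous f -> continuous (fun x => sqrtC (f x)).
Proof.
move=> f0 cf x; apply/(@cvgrPdist_lt C C X (nbhs x) (nbhs_filter x)) => e e0.
have e2 : 0 < e ^+ 2 by rewrite exprn_gt0.
have := @cvgr_dist_lt C C X (nbhs x) (nbhs_filter x) f (f x) (cf x) _ e2.
apply: filterS => y; set a := f x; set b := f y => abe.
have a0 : 0 <= a by exact: f0.
have b0 : 0 <= b by exact: f0.
have [sa sb] : 0 <= sqrtC a /\ 0 <= sqrtC b by rewrite !sqrtC_ge0.
(* The squared distance of the two roots is at most [|a - b|]: factor [a - b] as a difference of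
   squares and bound the difference of the roots by their sum. *)
rewrite -(@ltr_pXn2r _ 2) ?nnegrE ?(ltW e0)//; apply: le_lt_trans abe.
rewrite -[a in leRHS]sqrtCK -[b in leRHS]sqrtCK subr_sqr normrM expr2.
rewrite ler_wpM2l// (le_trans (ler_normB _ _))// !ger0_norm//.
exact: addr_ge0.
Qed.

Section ContinuousFunctionMorphism.
Variables (R : realType) (X : ptopologicalType) (A : cstarAlgType (complexF R)).
Notation C := (complexF R).
Notation CX := (continuousType X C).
Variables (Phi : {lrmorphism CX -> A}) (Phistar : star_preserving Phi).
Implicit Types (f g : CX) (M : C).

Lemma cfunP f g : (forall x, f x = g x) -> f = g.
Proof. by move=> fg; apply/continuousEP => x; exact: fg. Qed.

Lemma cfun_sa f : (forall x, f x \is Num.real) -> star f = f.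
Proof. by move=> fr; apply: cfunP => x; rewrite cfun_starE; exact/CrealP. Qed.

Lemma cfun_norm_continuous f : continuous (fun x => `|f x|).
Proof.
move=> x; apply: (@cvg_norm _ C _ (nbhs x) (nbhs_filter x) f (f x)).
exact: cts_fun.
Qed.

Let PhiZ c f : Phi (c *: f) = c *: Phi f.
Proof. exact: linearZ_LR. Qed.

Let PhiM f g : Phi (f * g) = Phi f * Phi g.
Proof. exact: rmorphM. Qed.
Let PhiD f g : Phi (f + g) = Phi f + Phi g.
Proof. exact: rmorphD. Qed.
Let PhiB f g : Phi (f - g) = Phi f - Phi g.
Proof. exact: rmorphB. Qed.
Let Phi0 : Phi 0 = 0.
Proof. exact: rmorph0. Qed.
Let Phi1 : Phi 1 = 1.
Proof. exact: rmorph1. Qed.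

(* [M^2 - |f|^2] has a self-adjoint square root. *)
Lemma cfun_morphism_le f M : (forall x, `|f x| <= M) -> `|Phi f| <= M.
Proof.
move=> fM; have M0 : 0 <= M by exact: le_trans (fM point).
pose k : CX := mkcts (@cfun_norm_continuous f).
have Mk0 x : 0 <= M * M - k x * k x.
  by rewrite subr_ge0 -!expr2 lerXn2r ?nnegrE /= ?normr_ge0 ?fM.
have cMk : continuous (fun x => M * M - k x * k x).
  move=> x; apply: (@cvgB C C X (nbhs x) (nbhs_filter x) (fun=> M * M)
    (fun y => k y * k y)); first exact: cvg_cst.
  by apply: (@cvgM _ _ (nbhs x) (nbhs_filter x)); exact: cts_fun.
pose g : CX := mkcts (continuous_sqrtC Mk0 cMk).
have ksa : star k = k by apply: cfun_sa => x; exact: normr_real.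
have gsa : star g = g by apply: cfun_sa => x; apply: ger0_real; rewrite sqrtC_ge0.
have kg : k * k + g * g = (M * M) *: (1 : CX).
  apply: cfunP => x; rewrite cfunDE !cfunME cfunZE cfun1E mulr1.
  by rewrite -[g x * g x]expr2 sqrtCK addrC subrK.
have fk : star f * f = k * k.
  by apply: cfunP => x; rewrite !cfunME cfun_starE mulrC -normCK -expr2.
rewrite -(@ler_pXn2r _ 2) ?nnegrE//.
rewrite -cstar_normE -Phistar -PhiM fk PhiM norm_sa_sqr -?Phistar ?ksa//.
have -> : M ^+ 2 = `|Phi k * Phi k + Phi g * Phi g|.
  rewrite expr2.
  have /(congr1 Phi) := kg.
  rewrite PhiZ PhiD !PhiM Phi1 => ->; rewrite normrZ cstar_norm1 mulr1.
  by rewrite ger0_norm// mulr_ge0.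
by apply: norm_sqr_le_add; rewrite -?Phistar ?ksa ?gsa// -!PhiM mulrC.
Qed.

Hypotheses (Phi_inj : injective Phi) (Phi_closed : closed (range Phi)).

(* [4 |Phi f|^2 - Phi (star f * f)] has a self-adjoint square root in [A], hence in the
   closed range of [Phi], so that [4 |Phi f|^2 - |f|^2] is the square of a real function. *)
Lemma cfun_morphism_ge f x : `|f x| <= 2 * `|Phi f|.
Proof.
have [->|f0] := eqVneq f 0; first by rewrite normr0 mulr_ge0.
have Pf0 : `|Phi f| != 0.
  by rewrite normr_eq0 -Phi0; apply: contra_neq f0; exact: Phi_inj.
(* With this scaling [Phi k] has norm exactly 1/4, as [sqrt_one_sub] allows. *)
pose c := (2 * `|Phi f|) ^- 2.
have c0 : 0 < c by rewrite invr_gt0 exprn_gt0// mulr_gt0// lt_def Pf0/=.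
have cconj : c^* = c by apply/CrealP/ger0_real/ltW.
have [k kE] : exists k, k = c *: (star f * f) by exists (c *: (star f * f)).
pose Q := [set s : A | star s = s] `&` range Phi.
have [t [/= tsa [s _ st]] ss] :
    exists2 s, Q s & (1 - s) * (1 - s) = 1 - Phi k.
  apply: sqrt_one_sub.
  - rewrite kE PhiZ normrZ gtr0_norm// PhiM Phistar cstar_normE.
    by rewrite /c exprMn invfM mulfVK ?expf_neq0// expr2 -natrM.
  - apply: closedI => //; apply: closed_equalizer; first exact: continuous_star.
    by move=> ?; exact: cvg_id.
  - by split; [exact: star0|exists 0; rewrite ?Phi0].
  - move=> t [/= tsa [s _ st]]; split=> /=.
      rewrite starZ starD starM tsa -Phistar kE starZ starM starK cconj.
      by rewrite fmorphV rmorph_nat.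
    by exists (2^-1 *: (k + s * s)); rewrite // PhiZ PhiD PhiM st.
subst t.
have ssa : star s = s by apply: Phi_inj; rewrite -[RHS]tsa; exact: Phistar.
have {}ss : (1 - s) * (1 - s) = 1 - k.
  by apply: Phi_inj; rewrite PhiM !PhiB Phi1.
have sr : 1 - s x \is Num.real.
  by rewrite rpredB ?rpred1//; apply/CrealP; rewrite -cfun_starE ssa.
have kx : k x = c * `|f x| ^+ 2.
  by rewrite kE cfunZE cfunME cfun_starE mulrC [_^* * _]mulrC -normCK mulrC.
have : 0 <= 1 - k x.
  have <- : (1 - s x) * (1 - s x) = 1 - k x by exact: (congr1 (fun h : CX => h x) ss).
  by rewrite -expr2 real_exprn_even_ge0.
have Pf_gt0 : 0 < `|Phi f| by rewrite lt_def Pf0 normr_ge0.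
rewrite subr_ge0 kx mulrC ler_pdivrMr ?mul1r ?exprn_gt0// ?mulr_gt0//.
by rewrite ler_pXn2r ?nnegrE// mulr_ge0.
Qed.

End ContinuousFunctionMorphism.


(** * Ideals of continuous functions on a compact space *)

Section CompactSpace.
Variables (C : numClosedFieldType) (X : ptopologicalType).
Notation CX := (continuousType X C).
Implicit Types (f g h : CX) (J : set CX) (K Y : set X).

Definition function_ideal J :=
  [/\ J 0, forall f g, J f -> J g -> J (f + g) & forall f g, J g -> J (f * g)].

Lemma open_norm_gt1 f : open [set x | 1 < `|f x|].
Proof.
rewrite openE => x /= fx1; rewrite /interior /=.
have e0 : 0 < `|f x| - 1 by rewrite subr_gt0.
have := @cvgr_dist_lt C C X (nbhs x) (nbhs_filter x) f (f x) (@cts_fun _ _ f x) _ e0.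
apply: filterS => y /= xy; have := le_lt_trans (lerB_dist _ _) xy.
by rewrite ltrD2l ltrN2.
Qed.

Lemma sum_normsq_ideal J (s : seq CX) : function_ideal J ->
  (forall g, g \in s -> J g) -> J (\sum_(g <- s) star g * g).
Proof.
move=> [J0 JD JM] sJ; rewrite big_seq; elim/big_rec: _ => // g f gs Jf.
by apply: JD => //; apply/JM/sJ.
Qed.

Lemma cfun_sumE (I : Type) (s : seq I) (F : I -> CX) x :
  (\sum_(i <- s) F i) x = \sum_(i <- s) F i x.
Proof. by elim/big_rec2: _ => // i _ g _ <-. Qed.

Lemma cfunBE f g x : (f - g) x = f x - g x. Proof. by []. Qed.

(** Rescaled elements of [J] exceed modulus 1 on open sets covering [K]. Summing [star g * g] over a
    finite subcover stays in [J], and one term already exceeds 1 at each point of [K]. *)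
Lemma compact_ideal_ge1 K J : compact K -> function_ideal J ->
    (forall x, K x -> exists2 g, J g & g x != 0) ->
  exists2 g, J g & (forall x, 0 <= g x) /\ (forall x, K x -> 1 <= g x).
Proof.
rewrite compact_cover => cK Jideal Jx; have [J0 JD JM] := Jideal.
have [g|x Kx|D DJ KD] := cK CX J (fun g => [set x | 1 < `|g x|]).
- by move=> _; exact: open_norm_gt1.
- have [g Jg gx] := Jx x Kx; exists ((2 / g x) *: 1 * g); first exact: JM.
  rewrite /= cfunME cfunZE cfun1E mulr1 mulfVK// ger0_norm//.
  by rewrite ltr1n.
have normsqE g x : (star g * g) x = `|g x| ^+ 2.
  by rewrite cfunME cfun_starE mulrC -normCK.
exists (\sum_(g <- finmap.enum_fset D) star g * g).
  by apply: sum_normsq_ideal => // g /DJ /set_mem.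
split=> x => [|Kx]; rewrite cfun_sumE.
  by apply: sumr_ge0 => g _; rewrite normsqE exprn_ge0.
have [g /= gD gx] := KD x Kx.
rewrite (big_rem g)//= normsqE (@le_trans _ _ (`|g x| ^+ 2))//.
  by rewrite exprn_ege1// ltW.
by rewrite lerDl sumr_ge0// => k _; rewrite normsqE exprn_ge0.
Qed.

Hypothesis compactX : compact [set: X].

(* [max (g x) 1] for a real-valued [g]. *)
Let max1 g x : C := (g x + 1 + `|g x - 1|) / 2.

Let max1_ge g x : 1 <= g x -> max1 g x = g x.
Proof.
move=> g1; rewrite /max1 ger0_norm ?subr_ge0// addrA addrAC addrK.
by rewrite -mulr2n -[_ *+ 2]mulr_natr mulfK// pnatr_eq0.
Qed.

Let max1_le g x : g x <= 1 -> max1 g x = 1.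
Proof.
move=> g1; rewrite /max1 ler0_norm ?subr_le0// opprB addrC addrA subrK.
by rewrite -mulr2n mulfV// pnatr_eq0.
Qed.

Let max1_continuous g : continuous (max1 g).
Proof.
have c1 : continuous (fun x => g x - 1).
  by move=> x; apply: (@cvgB C C X (nbhs x) (nbhs_filter x) g (fun=> 1));
    [exact: cts_fun|exact: cvg_cst].
move=> x; apply: (@cvgM _ _ (nbhs x) (nbhs_filter x)); last exact: cvg_cst.
apply: (@cvgD C C X (nbhs x) (nbhs_filter x) (fun y => g y + 1) (fun y => `|g y - 1|)).
  by apply: (@cvgD C C X (nbhs x) (nbhs_filter x) g (fun=> 1));
    [exact: cts_fun|exact: cvg_cst].
by apply: (@cvg_norm _ C _ (nbhs x) (nbhs_filter x)); exact: c1.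
Qed.

(** Apply [compact_ideal_ge1] on [Y] to the ideal of functions vanishing at [p]. The resulting [g]
    is at least 1 on [Y] and 0 at [p], so [max (g, 1) - g] vanishes on [Y] and is 1 at [p]. *)
Lemma cfun_separation Y p : closed Y -> ~ Y p ->
    (forall q : X, q != p -> exists f : CX, f q != f p) ->
  exists2 f : CX, vanishing_ideal Y f & f p != 0.
Proof.
move=> cY Yp sep.
have idp : function_ideal [set f : CX | f p = 0].
  split=> [//|f g /= fp gp|f g /= gp]; first by rewrite cfunDE fp gp addr0.
  by rewrite cfunME gp mulr0.
have cK : compact Y by apply: subclosed_compact compactX _.
have [|g /= gp [g0 g1]] := compact_ideal_ge1 cK idp.
  move=> q Yq; have [|f fqp] := sep q; first by apply: contra_notN Yp => /eqP <-.
  exists (f - f p *: 1); rewrite /= cfunBE cfunZE cfun1E mulr1 ?subrr//.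
  by rewrite subr_eq0.
pose m : CX := mkcts (@max1_continuous g).
exists (m - g) => [y Yy|]; rewrite cfunBE.
  by rewrite [m y]max1_ge ?subrr//; exact: g1.
by rewrite [m p]max1_le gp ?subr0 ?oner_eq0.
Qed.

(* If [g] in [J] is at least 1 where [|h| >= e], then [h g / max (g, 1)]
   is within [e] of [h]. *)
Lemma closed_ideal_zeros J h : function_ideal J ->
    (forall f, (forall e, 0 < e -> exists2 g, J g & forall x, `|f x - g x| <= e) ->
      J f) ->
    (forall y, (forall f, J f -> f y = 0) -> h y = 0) ->
  J h.
Proof.
move=> Jideal Jclosed hJ; have [_ _ JM] := Jideal.
apply: Jclosed => e e0; pose K := [set x | e <= `|h x|].
have [||g Jg [g0 g1]] := @compact_ideal_ge1 K J _ Jideal.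
- apply: subclosed_compact compactX _ => //.
  rewrite -openC openE => x /= /negP; rewrite -real_ltNge ?normr_real ?gtr0_real// => hx.
  have d0 : 0 < e - `|h x| by rewrite subr_gt0.
  have := @cvgr_dist_lt C C X (nbhs x) (nbhs_filter x) h (h x) (@cts_fun _ _ h x) _ d0.
  apply: filterS => y /= xy; apply/negP; rewrite -real_ltNge ?normr_real ?gtr0_real//.
  rewrite distrC in xy.
  by have := le_lt_trans (lerB_dist _ _) xy; rewrite ltrD2r.
(* If all of [J] vanished at [x], so would [h], against [e <= |h x|]. *)
- move=> x Kx; apply: contrapT => gx; suff hx0 : h x = 0.
    by have := lt_le_trans e0 Kx; rewrite hx0 normr0 ltxx.
  apply: hJ => f Jf; apply: contrapT => /eqP fx; apply: gx.
  by exists f.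
have greal x : g x \is Num.real by exact/ger0_real.
have m1 x : 1 <= max1 g x.
  have /orP[g1x|g1x] := real_leVge (greal x) (@real1 C).
    by rewrite max1_le.
  by rewrite max1_ge.
have u_cts : continuous (fun x => (max1 g x)^-1).
  move=> x; apply: (@cvgV _ _ (nbhs x) (nbhs_filter x)); last exact: max1_continuous.
  by rewrite gt_eqF// (lt_le_trans ltr01).
pose u : CX := mkcts u_cts.
have uE x : u x = (max1 g x)^-1 by [].
exists (h * u * g); first exact: JM.
move=> x; rewrite !cfunME -mulrA -[h x in X in X - _]mulr1 -mulrBr normrM.
(* The error is [|h| (1 - u g)]: it is 0 on [K], where [u g = 1], and at most [|h| < e] elsewhere,
   as [u g] lies between 0 and 1. *)
have [Kx|Kx] := pselect (K x).
  rewrite [u x * g x](_ : _ = 1) ?subrr ?normr0 ?mulr0 ?(ltW e0)//.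
  by rewrite uE max1_ge ?mulVf ?g1// gt_eqF// (lt_le_trans ltr01)// g1.
rewrite (@le_trans _ _ `|h x|)//; last first.
  rewrite ltW// real_ltNge ?normr_real ?gtr0_real//; exact/negP.
have ug0 : 0 <= u x * g x by rewrite uE mulr_ge0// invr_ge0 (le_trans ler01).
have ug1 : u x * g x <= 1.
  rewrite uE mulrC ler_pdivrMr ?mul1r ?(lt_le_trans ltr01)//.
  have /orP[g1x|g1x] := real_leVge (greal x) (@real1 C).
    by rewrite max1_le.
  by rewrite max1_ge.
rewrite ler_piMr// ger0_norm ?subr_ge0//.
by rewrite gerBl.
Qed.

End CompactSpace.

(** * Compactness of discs and of subspaces *)

Section ComplexCompactness.
Variable R : realType.
Notation C := (complexF R).

Lemma norm_real_complex (x : R) : `|real_complex R x : C| = real_complex R `|x|.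
Proof. by rewrite normc_def/= expr0n/= addr0 sqrtr_sqr. Qed.

Lemma continuous_real_complex : continuous (real_complex R : R -> C).
Proof.
move=> x; apply/cvgrPdist_lt => -[e1 e2]; rewrite ltcE/= => /andP[/eqP-> e0].
have /cvgrPdist_lt/(_ _ e0) : y @[y --> x] --> x by exact: cvg_id.
by apply: filterS => y xy; rewrite -rmorphB norm_real_complex ltcR.
Qed.

(** The disc is a closed part of the image of the compact square [I * I] under the continuous map
    [x + i y]. *)
Lemma compact_disc : compact [set z : C | `|z| <= 1].
Proof.
pose I := `[(-1 : R), 1]%classic.
pose F (p : R * R) : C := real_complex R p.1 + real_complex R p.2 * 'i.
have cF : continuous F.
  move=> p; apply: (@cvgD C C _ (nbhs p) (nbhs_filter p)
    (fun p => real_complex R p.1) (fun p => real_complex R p.2 * 'i)).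
    by apply: continuous_comp; [exact: cvg_fst|exact: continuous_real_complex].
  apply: (@cvgM C _ (nbhs p) (nbhs_filter p) (fun p => real_complex R p.2)
    (fun=> 'i)); last exact: cvg_cst.
  by apply: continuous_comp; [exact: cvg_snd|exact: continuous_real_complex].
have cI : compact (I `*` I) by apply: compact_setX; exact: segment_compact.
have cFI := continuous_compact (continuous_subspaceT cF) cI.
apply: subclosed_compact cFI _.
  apply/(@closedP_dist _ C) => z zD; apply/ler_addgt0Pr => e /zD[y /= y1 zy].
  rewrite -(subrK y z) addrC (le_trans (ler_normD _ _))// lerD// ltW//.
move=> z /= z1; exists (complex.Re z, complex.Im z); last first.
  by rewrite /F/= -complexiE mulrC -complexE.
have normI (x : R) : (`|x|%:C <= (1 : C))%C -> I x.
  by rewrite /I/= in_itv/= -ler_norml -[1 in X in X -> _]/(real_complex R 1) lecR.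
split; apply: normI; first exact: le_trans (normc_ge_Re z) z1.
rewrite -[complex.Im z]opprK -ReiNIm normrN (le_trans (normc_ge_Re _))// normrM.
by rewrite complexiE normCi mulr1.
Qed.

End ComplexCompactness.

Lemma continuous_sum (C : numFieldType) (T : topologicalType) (I : Type)
  (s : seq I) (F : I -> T -> C) :
  (forall i, continuous (F i)) -> continuous (fun x => \sum_(i <- s) F i x).
Proof.
move=> cF; elim: s => [|i s IH] x.
  by under eq_fun do rewrite big_nil; exact: cvg_cst.
under eq_fun do rewrite big_cons.
by apply: (@cvgD C C T (nbhs x) (nbhs_filter x) (F i)
  (fun x => \sum_(i <- s) F i x)); [exact: cF|exact: IH].
Qed.

(** Push the filter forward along [set_val]: a cluster point in [K] of the image is one of the
    original filter, since the open sets of the subtype are traces of open sets. *)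
Lemma compact_set_type (T : topologicalType) (K : set T) :
  compact K -> compact [set: set_type K].
Proof.
move=> cK F FF _.
have FK : (set_val @ F) K.
  by rewrite /nbhs /=; apply: filterS (@filterT _ F _) => x _; exact: set_valP.
have [p [Kp clp]] := cK (set_val @ F) _ FK.
exists (SigSub (mem_set Kp)); split=> // U V FU [W [[B oB <-] /= Bp BV]].
have [|_ [[x Ux <-] Bx]] := clp (set_val @` U) B _ (open_nbhs_nbhs (conj oB Bp)).
  by apply: (filterS (P := U)) FU => x Ux; exists x.
by exists x; split=> //; exact: BV.
Qed.

(** * Compactness, coordinates and conjugation of the projective space *)

Section ProjectiveSpaceTopology.
Variables (R : realType) (n : nat).
Notation C := (complexF R).
Notation S := (set_type (@complex_sphere C n.+1)).
Notation P := (cproj C n.+1).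
Local Open Scope quotient_scope.

Lemma compact_complex_sphere : compact (@complex_sphere C n.+1).
Proof.
apply: subclosed_compact (@rV_compact C n.+1 (fun=> [set z | `|z| <= 1]) _) _.
- apply: (@closed_comp _ C (fun x : 'rV[C]_n.+1 => \sum_i `|x 0 i| ^+ 2) [set 1]).
    move=> x _; apply: continuous_sum => i {}x.
    under eq_fun do rewrite expr2.
    have cn : continuous (fun x : 'rV[C]_n.+1 => `|x 0 i|).
      move=> {}x; apply: (@cvg_norm _ C _ (nbhs x) (nbhs_filter x)).
      exact: coord_continuous.
    by apply: (@cvgM C _ (nbhs x) (nbhs_filter x)); exact: cn.
  exact: accessible_closed_set1 (hausdorff_accessible (@norm_hausdorff _ C)) _.
- by move=> i; exact: compact_disc.
- move=> x; rewrite /complex_sphere/= => x1 i.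
  rewrite -(@ler_pXn2r _ 2) ?nnegrE// expr1n -x1 (bigD1 i)//= lerDl.
  by apply: sumr_ge0 => j _; rewrite exprn_ge0.
Qed.

Lemma compact_cproj : compact [set: P].
Proof.
rewrite (_ : [set: P] = (\pi_P : S -> P) @` setT).
  apply: continuous_compact; last exact: compact_set_type compact_complex_sphere.
  by apply: continuous_subspaceT; exact: pi_continuous.
by apply/seteqP; split=> // p _; exists (repr p); rewrite ?reprK.
Qed.

(** Fix [j] with [x_j] nonzero. The case [i = j] gives [|x_j| = |y_j|], so [y_j / x_j] is a phase;
    the other [i] show that it carries [x] to [y]. *)
Lemma zz_separation (p q : P) : (forall i j, zz i j p = zz i j q) -> p = q.
Proof.
rewrite -[p]reprK -[q]reprK; move: (repr p) (repr q) => {p q} x y xy.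
apply/cprojP/asboolP.
have {}xy i j : \val x 0 i * (\val x 0 j)^* = \val y 0 i * (\val y 0 j)^*.
  by have := xy i j; rewrite !zzE.
have [j xj] : exists j, \val x 0 j != 0.
  apply: contrapT => /forallNP x0; have := complex_sphereP x.
  rewrite big1 => [/eqP|j _]; first by rewrite eq_sym oner_eq0.
  by have /negP/negPn/eqP -> := x0 j; rewrite normr0 expr0n.
have nxy : `|\val x 0 j| = `|\val y 0 j|.
  by apply/eqP; rewrite -(@eqrXn2 _ 2)// !normCK xy.
have yj : \val y 0 j != 0 by rewrite -normr_eq0 -nxy normr_eq0.
exists (\val y 0 j / \val x 0 j).
  by rewrite normrM normfV nxy mulfV// normr_eq0.
apply/rowP => i; rewrite mxE; apply: (@mulIf _ (\val y 0 j)^*).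
  by rewrite conjC_eq0.
have -> : \val y 0 j / \val x 0 j * \val x 0 i * (\val y 0 j)^* =
    \val y 0 j * (\val y 0 j)^* * \val x 0 i / \val x 0 j.
  by rewrite mulrAC [_ / _ * _^*]mulrAC mulrAC.
by rewrite -!xy [RHS]mulrAC [_ / _]mulrAC mulfV// mul1r mulrC.
Qed.

Lemma conj_sphere_continuous : continuous (@conj_sphere C n.+1).
Proof.
apply: continuous_comp_initial.
have cconj : continuous (map_mx Num.conj : 'rV[C]_n.+1 -> 'rV[C]_n.+1).
  move=> x; apply/(@cvg_ballP C 'rV[C]_n.+1 _ (nbhs x) (nbhs_filter x)) => e e0.
  apply/nbhs_ballP; exists e => //= y [_ xy]; split=> // i j; rewrite !mxE -ball_normE/=.
  by rewrite -rmorphB norm_conjC; have := xy i j; rewrite -ball_normE.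
move=> x; apply: (@continuous_comp _ _ _ (set_val : S -> _) (map_mx Num.conj)).
  exact: initial_continuous.
exact: cconj.
Qed.

Lemma cproj_conj_continuous : continuous (@cproj_conj C n.+1).
Proof.
apply/quotient_continuous.
rewrite (_ : _ \o _ = (\pi_P : S -> P) \o @conj_sphere C n.+1); last first.
  by apply/funext => x /=; rewrite cproj_conjE.
move=> x; apply: continuous_comp; first exact: conj_sphere_continuous.
exact: pi_continuous.
Qed.

Lemma cproj_conjK : involutive (@cproj_conj C n.+1).
Proof.
move=> p; rewrite -[p]reprK; move: (repr p) => {p} x.
rewrite [X in cproj_conj X]cproj_conjE cproj_conjE; congr (\pi _); apply: val_inj.
by apply/rowP => i; rewrite !mxE conjCK.
Qed.

End ProjectiveSpaceTopology.

(** * Closed ideals and generated ideals *)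

Section IdealGen.
Variables (C : numClosedFieldType) (A : cstarAlgType C).
Implicit Types (S I : set A).

Lemma sub_ideal_gen S : S `<=` ideal_gen S.
Proof. exact: sub_smallest. Qed.

Lemma ideal_gen_sub S I : closed_ideal I -> S `<=` I -> ideal_gen S `<=` I.
Proof. by move=> cI SI x; apply; split. Qed.

Lemma ideal_gen_closed_ideal S : closed_ideal (ideal_gen S).
Proof.
split=> [I [[I0 _ _ _ _] _]//|x y Sx Sy I cIS|a x Sx I cIS|a x Sx I cIS|].
- by have [[_ ID _ _ _] _] := cIS; apply: ID; [exact: Sx|exact: Sy].
- by have [[_ _ IL _ _] _] := cIS; apply: IL; exact: Sx.
- by have [[_ _ _ IR _] _] := cIS; apply: IR; exact: Sx.
- by apply: closed_bigI => I [[]].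
Qed.

Lemma closed_idealN I x : closed_ideal I -> I x -> I (- x).
Proof. by case=> _ _ IL _ _ Ix; rewrite -mulN1r; exact: IL. Qed.

Lemma closed_idealZ I c x : closed_ideal I -> I x -> I (c *: x).
Proof. by case=> _ _ IL _ _ Ix; rewrite -[x]mul1r scalerAl; exact: IL. Qed.

Lemma closed_ideal_sum I (s : finType) (F : s -> A) : closed_ideal I ->
  (forall i, I (F i)) -> I (\sum_i F i).
Proof. by case=> I0 ID _ _ _ IF; elim/big_ind: _. Qed.

End IdealGen.

(** * The grading of the half-liberated sphere by the sign automorphism *)

Section Grading.
Variables (R : realType) (n : nat) (A : cstarAlgType (complexF R)).
Variables (v : 'I_n.+1 -> A) (Av : is_half_liberated_sphere v).
Notation nu := (sign Av).
Implicit Types x y : A.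

Lemma sphere_rel : half_liberated_relations v. Proof. by case: Av. Qed.

Lemma star_v i : star (v i) = v i. Proof. by case: sphere_rel. Qed.

Lemma v_half i j k : v i * v j * v k = v k * v j * v i.
Proof. by case: sphere_rel. Qed.

Lemma sum_vv : \sum_i v i * v i = 1.
Proof. by case: sphere_rel => <- _ _; apply: eq_bigr => i _; rewrite expr2. Qed.

(** Serves as an induction principle over the algebra, for properties stable under the operations
    and limits. *)
Lemma sphere_generated (B : set A) : closed_star_subalgebra B ->
  (forall i, B (v i)) -> forall x, B x.
Proof.
move=> cB Bv x; have [_ gen _] := Av.
have : setT x by []; rewrite -gen; apply; split=> // _ [i _ <-]; exact: Bv.
Qed.

Let nuN x : nu (- x) = - nu x. Proof. exact: rmorphN. Qed.
Let nuD x y : nu (x + y) = nu x + nu y. Proof. exact: rmorphD. Qed.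
Let nuB x y : nu (x - y) = nu x - nu y. Proof. exact: rmorphB. Qed.
Let nuM x y : nu (x * y) = nu x * nu y. Proof. exact: rmorphM. Qed.
Let nuZ c x : nu (c *: x) = c *: nu x. Proof. exact: linearZ_LR. Qed.
Let nu1 : nu 1 = 1. Proof. exact: rmorph1. Qed.

Lemma sign_continuous : continuous nu.
Proof. exact: star_morphism_continuous (sign_star Av). Qed.

Lemma signK : involutive nu.
Proof.
apply: sphere_generated => [|i]; last by rewrite sign_gen nuN sign_gen opprK.
split=> [|c x y nx ny|x y nx ny|x nx|].
- by rewrite !nu1.
- by rewrite !(nuD, nuZ) nx ny.
- by rewrite !nuM nx ny.
- by rewrite !sign_star nx.
- apply: closed_equalizer => x; last exact: cvg_id.
  by apply: continuous_comp; exact: sign_continuous.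
Qed.

(** The projections onto the eigenspaces of the sign automorphism for 1 and -1. *)
Definition even_comp x := 2^-1 *: (x + nu x).
Definition odd_comp x := 2^-1 *: (x - nu x).
Notation e := even_comp.
Notation o := odd_comp.

Lemma comp_split x : e x + o x = x.
Proof.
rewrite -scalerDr addrACA subrr addr0 -mulr2n -[x *+ 2]scaler_nat scalerA.
by rewrite mulVf ?scale1r// pnatr_eq0.
Qed.

Lemma even_comp_even x : even_part Av (e x).
Proof. by rewrite /even_part/= nuZ nuD signK addrC. Qed.

Lemma odd_comp_odd x : odd_part Av (o x).
Proof. by rewrite /odd_part/= nuZ nuB signK -scalerN opprB. Qed.

Lemma even_comp_id x : even_part Av x -> e x = x.
Proof.
move=> xe; rewrite /even_comp [nu x]xe -mulr2n -[x *+ 2]scaler_nat scalerA.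
by rewrite mulVf ?scale1r// pnatr_eq0.
Qed.

Lemma odd_comp_even x : even_part Av x -> o x = 0.
Proof. by move=> xe; rewrite /odd_comp [nu x]xe subrr scaler0. Qed.

Lemma even_comp_odd x : odd_part Av x -> e x = 0.
Proof. by move=> xo; rewrite /even_comp [nu x]xo subrr scaler0. Qed.

Lemma odd_comp_id x : odd_part Av x -> o x = x.
Proof. by move=> xo; rewrite -[RHS]comp_split (even_comp_odd xo) add0r. Qed.

Lemma even_compD x y : e (x + y) = e x + e y.
Proof. by rewrite /even_comp nuD addrACA scalerDr. Qed.

Lemma odd_compD x y : o (x + y) = o x + o y.
Proof. by rewrite /odd_comp nuD opprD addrACA scalerDr. Qed.

Lemma even_compZ c x : e (c *: x) = c *: e x.
Proof. by rewrite /even_comp nuZ -scalerDr !scalerA mulrC. Qed.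

Lemma odd_compZ c x : o (c *: x) = c *: o x.
Proof. by rewrite /odd_comp nuZ -scalerBr !scalerA mulrC. Qed.

Lemma even_evenM x y : even_part Av x -> even_part Av y -> even_part Av (x * y).
Proof. by rewrite /even_part/= nuM => -> ->. Qed.

Lemma odd_oddM x y : odd_part Av x -> odd_part Av y -> even_part Av (x * y).
Proof. by rewrite /even_part/odd_part/= nuM => -> ->; rewrite mulrNN. Qed.

Lemma even_oddM x y : even_part Av x -> odd_part Av y -> odd_part Av (x * y).
Proof. by rewrite /even_part/odd_part/= nuM => -> ->; rewrite mulrN. Qed.

Lemma odd_evenM x y : odd_part Av x -> even_part Av y -> odd_part Av (x * y).
Proof. by rewrite /even_part/odd_part/= nuM => -> ->; rewrite mulNr. Qed.

Lemma odd_v i : odd_part Av (v i). Proof. exact: sign_gen. Qed.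

Lemma even_compM x y : e (x * y) = e x * e y + o x * o y.
Proof.
rewrite -[x in LHS]comp_split -[y in LHS]comp_split mulrDl !mulrDr !even_compD.
have [ex ey] := (even_comp_even x, even_comp_even y).
have [ox oy] := (odd_comp_odd x, odd_comp_odd y).
rewrite (even_comp_id (even_evenM ex ey)) (even_comp_id (odd_oddM ox oy)).
rewrite (even_comp_odd (even_oddM ex oy)) (even_comp_odd (odd_evenM ox ey)).
by rewrite addr0 add0r.
Qed.

Lemma odd_compM x y : o (x * y) = e x * o y + o x * e y.
Proof.
rewrite -[x in LHS]comp_split -[y in LHS]comp_split mulrDl !mulrDr !odd_compD.
have [ex ey] := (even_comp_even x, even_comp_even y).
have [ox oy] := (odd_comp_odd x, odd_comp_odd y).
rewrite (odd_comp_even (even_evenM ex ey)) (odd_comp_even (odd_oddM ox oy)).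
rewrite (odd_comp_id (even_oddM ex oy)) (odd_comp_id (odd_evenM ox ey)).
by rewrite addr0 add0r.
Qed.

Lemma even_comp_star x : e (star x) = star (e x).
Proof. by rewrite /even_comp starZ starD sign_star fmorphV rmorph_nat. Qed.

Lemma odd_comp_star x : o (star x) = star (o x).
Proof. by rewrite /odd_comp starZ starB sign_star fmorphV rmorph_nat. Qed.

Lemma even_comp_continuous : continuous e.
Proof.
move=> x; apply: cvgZr; apply: cvgD; first exact: cvg_id.
exact: sign_continuous.
Qed.

Lemma odd_comp_continuous : continuous o.
Proof.
move=> x; apply: cvgZr; apply: cvgB; first exact: cvg_id.
exact: sign_continuous.
Qed.

Lemma even_part_closed : closed (even_part Av).
Proof.
by apply: closed_equalizer => x; [exact: sign_continuous|exact: cvg_id].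
Qed.

(** Inserting the unit as the sum of the [v i * v i] turns a product of two odd elements into a sum
    of products of even ones. *)
Lemma insert_vv x y : x * y = \sum_i (x * v i) * (v i * y).
Proof.
under eq_bigr do rewrite mulrA -(mulrA x).
by rewrite -mulr_suml -mulr_sumr sum_vv mulr1.
Qed.

(* The elements determined by a set of even elements [B]: the odd component is
   recovered from its left products with the generators, as [\sum_i v_i^2 = 1]. *)
Definition even_lift (B : set A) : set A :=
  [set x | B (e x) /\ forall k, B (v k * o x)].

Lemma even_lift_closed B : closed B -> closed (even_lift B).
Proof.
move=> cB; rewrite (_ : even_lift B =
    e @^-1` B `&` \bigcap_(k in setT) (fun x => v k * o x) @^-1` B); last first.
  by apply/seteqP; split=> x [ex ox]; split=> // k; [move=> _|]; exact: ox.
apply: closedI; first by apply: closed_comp => // x _; exact: even_comp_continuous.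
apply: closed_bigI => k _; apply: closed_comp => // x _.
apply: (@continuous_comp _ _ _ o (fun y => v k * y)).
  exact: odd_comp_continuous.
exact: continuous_mull.
Qed.

(** [B] is an ideal of the even part, stable under multiplication by a generator on each side. Odd
    factors are paired with generators by [insert_vv], so that only these stabilities of [B] are
    called upon. *)
Lemma even_lift_ideal (B : set A) : B 0 ->
    (forall x y, B x -> B y -> B (x + y)) ->
    (forall x y, even_part Av x -> B y -> B (x * y)) ->
    (forall x y, B x -> even_part Av y -> B (x * y)) ->
    (forall x k l, B x -> B (v k * x * v l)) -> closed B ->
  closed_ideal (even_lift B).
Proof.
move=> B0 BD BL BR Bv cB.
have Bsum (F : 'I_n.+1 -> A) : (forall i, B (F i)) -> B (\sum_i F i).
  by move=> BF; elim/big_ind: _.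
split.
- have e0 : even_part Av 0 by rewrite /even_part/= rmorph0.
  by split=> [|k]; rewrite ?(even_comp_id e0) ?(odd_comp_even e0) ?mulr0.
- move=> x y [ex ox] [ey oy]; split=> [|k]; first by rewrite even_compD; exact: BD.
  by rewrite odd_compD mulrDr; exact: BD.
- move=> a x [ex ox]; have [ea oa] := (even_comp_even a, odd_comp_odd a).
  split=> [|k].
    rewrite even_compM; apply: BD; first exact: BL.
    rewrite insert_vv; apply/Bsum => i; apply/BL => //.
    by apply: odd_oddM => //; exact: odd_v.
  rewrite odd_compM mulrDr !mulrA; apply: BD.
    rewrite insert_vv; apply/Bsum => i; apply/BL => //.
    by apply: odd_oddM; [apply: odd_evenM => //|]; exact: odd_v.
  by apply/BL => //; apply: odd_oddM => //; exact: odd_v.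
- move=> a x [ex ox]; have [ea oa] := (even_comp_even a, odd_comp_odd a).
  have voa k : even_part Av (v k * o a) by apply: odd_oddM => //; exact: odd_v.
  split=> [|k].
    rewrite even_compM; apply: BD; first exact: BR.
    rewrite insert_vv; apply/Bsum => m; apply/BR => //.
    (* Only the left products [v l * o x] are known to lie in [B]; a second insertion makes one
       appear, between [v l] and [v m]. *)
    rewrite -(mul1r (o x * v m)) insert_vv; apply/Bsum => l.
    by rewrite mul1r (mulrA (v l) (o x)) mulrA; exact: Bv.
  rewrite odd_compM mulrDr !mulrA; apply: BD; last exact: BR.
  by rewrite insert_vv; apply/Bsum => m; apply/BR => //; exact: Bv.
- exact: even_lift_closed.
Qed.

(** Both components of [x] are combinations of [x] and [nu x], hence stay in [I]. *)
Lemma graded_of_sign_stable (I : set A) : closed_ideal I ->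
  (forall x, I x -> I (nu x)) -> graded Av I.
Proof.
move=> cI Inu; have [I0 ID _ _ _] := cI; split.
  apply/seteqP; split=> [x Ix|_ [x [Ix _] [y [Iy _] <-]]]; last exact: ID.
  exists (e x); first by split; [apply/(closed_idealZ _ cI)/ID/Inu|exact: even_comp_even].
  exists (o x); last exact: comp_split.
  split; last exact: odd_comp_odd.
  by apply/(closed_idealZ _ cI)/ID/(closed_idealN cI)/Inu.
apply/seteqP; split=> [x [[_ xe] [_ xo]]|_ ->]; last first.
  by rewrite /even_part/odd_part/= !rmorph0 oppr0.
by rewrite /= -[LHS](even_comp_id xe) (even_comp_odd xo).
Qed.

End Grading.

(** * The isomorphism with the even part and half-commutation with the generators *)

Section EvenPartIso.
Variables (R : realType) (n : nat) (A : cstarAlgType (complexF R)).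
Variables (v : 'I_n.+1 -> A) (Av : is_half_liberated_sphere v).
Notation C := (complexF R).
Notation P := (cproj C n.+1).
Notation CP := (continuousType P C).
Variables (Phi : {lrmorphism CP -> A}) (hPhi : is_even_part_iso Av Phi).
Implicit Types (f g h : CP) (Y : set P).

Let Phistar : star_preserving Phi. Proof. by case: hPhi. Qed.

Let PhiM f g : Phi (f * g) = Phi f * Phi g. Proof. exact: rmorphM. Qed.
Let PhiD f g : Phi (f + g) = Phi f + Phi g. Proof. exact: rmorphD. Qed.
Let PhiB f g : Phi (f - g) = Phi f - Phi g. Proof. exact: rmorphB. Qed.
Let PhiZ c f : Phi (c *: f) = c *: Phi f. Proof. exact: linearZ_LR. Qed.
Let Phi0 : Phi 0 = 0. Proof. exact: rmorph0. Qed.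
Let Phi1 : Phi 1 = 1. Proof. exact: rmorph1. Qed.

Lemma Phi_zz i j : Phi (zz i j) = v i * v j.
Proof. by case: hPhi. Qed.

Lemma Phi_even f : even_part Av (Phi f).
Proof. by case: hPhi => _ [Pf _ _] _; exact: Pf. Qed.

Lemma Phi_onto x : even_part Av x -> exists f, Phi f = x.
Proof. by case: hPhi => _ [_ _ Ps] _ => /Ps[f _ <-]; exists f. Qed.

Lemma Phi_injective : injective Phi.
Proof. by case: hPhi => _ [_ Pi _] _ f g fg; apply: Pi; rewrite ?in_setT. Qed.

Lemma Phi_range_closed : closed (range Phi).
Proof.
rewrite (_ : range Phi = even_part Av); first exact: even_part_closed.
apply/seteqP; split=> [_ [f _ <-]|x /Phi_onto[f <-]]; first exact: Phi_even.
by exists f.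
Qed.

Lemma Phi_le f (M : C) : (forall x, `|f x| <= M) -> `|Phi f| <= M.
Proof. exact: cfun_morphism_le. Qed.

Lemma Phi_ge f x : `|f x| <= 2 * `|Phi f|.
Proof. exact: cfun_morphism_ge Phistar Phi_injective Phi_range_closed _ _. Qed.

(** A limit of elements [Phi g] is even, hence some [Phi f], and [Phi_ge] turns approximation in [A]
    into uniform approximation of [f]. *)
Lemma Phi_image_closed (J : set CP) :
  (forall f, (forall e, 0 < e -> exists2 g, J g & forall x, `|f x - g x| <= e) ->
    J f) -> closed (Phi @` J).
Proof.
move=> Jc; apply/closedP_dist => x xJ.
have [f fx] : exists f, Phi f = x.
  apply: Phi_onto; apply: (closedP_dist _).1 (@even_part_closed _ _ _ _ Av) _ _ => e.
  by move=> /xJ[_ [g _ <-] ?]; exists (Phi g) => //; exact: Phi_even.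
exists f => //; apply: Jc => e e0; have e2 : 0 < e / 2 by rewrite divr_gt0.
have [_ [g Jg <-] fg] := xJ _ e2; exists g => // y.
rewrite -cfunBE (le_trans (Phi_ge _ _))// PhiB fx mulrC -ler_pdivlMr//.
exact: ltW.
Qed.

(** Conjugation acts here on the points, so this map is linear, unlike the pointwise conjugate
    [star]. *)
Definition cfun_conjP f : CP := mkcts (fun x =>
  continuous_comp (@cproj_conj_continuous R n x) (@cts_fun _ _ f _)).
Notation bar := cfun_conjP.

Lemma cfun_conjPE f x : bar f x = f (cproj_conj x). Proof. by []. Qed.

Lemma cfun_conjPK f : bar (bar f) = f.
Proof. by apply: cfunP => x; rewrite !cfun_conjPE cproj_conjK. Qed.

Lemma cfun_conjP_zz i j : bar (zz i j) = zz j i.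
Proof.
apply: cfunP => x; rewrite cfun_conjPE -[x]reprK; move: (repr x) => {}x.
by rewrite cproj_conjE !zzE /= !mxE conjCK mulrC.
Qed.

(** The second equation is the first one for [bar f]. Taking stars exchanges the two, so the pair is
    what makes the set stable under [star] as well as [bar]. *)
Definition half_commuting : set CP :=
  [set f | forall i, v i * Phi f = Phi (bar f) * v i /\ v i * Phi (bar f) = Phi f * v i].

Lemma half_commuting_subalgebra : closed_star_subalgebra (Phi @` half_commuting).
Proof.
split.
- exists 1; last exact: Phi1.
  move=> i; have -> : bar (1 : CP) = 1 by exact: cfunP.
  by rewrite Phi1 mul1r mulr1.
- move=> c _ _ [f Gf <-] [g Gg <-]; exists (c *: f + g); last by rewrite PhiD PhiZ.
  move=> i; have -> : bar (c *: f + g) = c *: bar f + bar g by exact: cfunP.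
  have [[f1 f2] [g1 g2]] := (Gf i, Gg i).
  by rewrite !PhiD !PhiZ !mulrDr !mulrDl -!scalerAr -!scalerAl f1 f2 g1 g2.
- move=> _ _ [f Gf <-] [g Gg <-]; exists (f * g); last exact: PhiM.
  move=> i; have -> : bar (f * g) = bar f * bar g by exact: cfunP.
  have [[f1 f2] [g1 g2]] := (Gf i, Gg i).
  by rewrite !PhiM !mulrA f1 f2 -!mulrA g1 g2.
- move=> _ [f Gf <-]; exists (star f); last exact: Phistar.
  move=> i; have -> : bar (star f) = star (bar f) by exact: cfunP.
  have [f1 f2] := Gf i; rewrite !Phistar -(star_v Av i) -!starM.
  by rewrite f1 f2.
- apply: Phi_image_closed => f fG i.
  suff approx a b : (forall e : C, 0 < e -> exists a' b' : A,
      [/\ v i * a' = b' * v i, `|a - a'| <= e & `|b - b'| <= e]) ->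
      v i * a = b * v i.
    split; apply: approx => e /fG[g Gg fg];
      [exists (Phi g), (Phi (bar g))|exists (Phi (bar g)), (Phi g)];
      have [g1 g2] := Gg i; split=> //; rewrite -PhiB; apply: Phi_le => x; exact: fg.
  move=> ab; apply/eqP; rewrite -subr_eq0 -normr_le0.
  apply/ler_addgt0Pr => e e0; rewrite add0r.
  (* Replacing [a], [b] by [a'], [b'] costs at most [2 |v i|] times the precision; adding 1 keeps
     the divisor positive. *)
  pose K := 2 * `|v i| + 1; have K0 : 0 < K by rewrite ltr_wpDl// mulr_ge0.
  have eK : 0 < e / K by rewrite divr_gt0.
  have [a' [b' [ab' aa bb]]] := ab _ eK.
  rewrite (_ : _ - _ = v i * (a - a') - (b - b') * v i); last first.
    by rewrite mulrBr mulrBl ab' opprB addrA subrK.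
  rewrite (le_trans (ler_normB _ _))//.
  rewrite (le_trans (lerD (cstar_ler_normM _ _) (cstar_ler_normM _ _)))//.
  rewrite (@le_trans _ _ (`|v i| * (e / K) + (e / K) * `|v i|))//.
    by rewrite lerD// ?ler_wpM2l ?ler_wpM2r.
  rewrite [_ * `|v i|]mulrC -mulrDl -mulr2n -[_ *+ 2]mulr_natl.
  by rewrite mulrA ler_pdivrMr// mulrC ler_wpM2l ?(ltW e0)// /K lerDl.
Qed.

(** The generators are odd, so the generation of [A] can only be exploited through a subalgebra
    having odd elements too; the even lift provides one. *)
Lemma even_lift_subalgebra :
  closed_star_subalgebra (even_lift Av (Phi @` half_commuting)).
Proof.
set G := Phi @` _; have [G1 GL GM Gs Gc] := half_commuting_subalgebra.
rewrite -/G in G1 GL GM Gs Gc.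
have G0 : G 0 by rewrite -(addNr 1) -scaleN1r; exact: GL.
have GD x y : G x -> G y -> G (x + y).
  by move=> Gx; rewrite -[x in x + y]scale1r; exact: GL.
have Gsum (F : 'I_n.+1 -> A) : (forall i, G (F i)) -> G (\sum_i F i).
  by move=> GF; elim/big_ind: _.
have Gvv i j : G (v i * v j).
  rewrite -Phi_zz; exists (zz i j) => // k; rewrite cfun_conjP_zz !Phi_zz !mulrA.
  by split; exact: (v_half Av).
have Gv x k l : G x -> G (v k * x * v l).
  move=> [f Gf <-]; rewrite (Gf k).1 -mulrA; apply: GM => //.
  by exists (bar f) => // i; rewrite cfun_conjPK; have [] := Gf i.
have Gov x l : even_lift Av G x -> G (odd_comp Av x * v l).
  move=> [_ ox]; rewrite -[odd_comp Av x]mul1r -(sum_vv Av) !mulr_suml.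
  by apply/Gsum => i; rewrite -(mulrA (v i)); exact: Gv.
split.
- have e1 : even_part Av 1 by rewrite /even_part/= rmorph1.
  by split=> [|k]; rewrite ?(even_comp_id e1) ?(odd_comp_even e1) ?mulr0.
- move=> c x y [ex ox] [ey oy]; split=> [|k].
    by rewrite even_compD even_compZ; exact: GL.
  by rewrite odd_compD odd_compZ mulrDr -scalerAr; exact: GL.
- move=> x y Gx Gy; have [[ex ox] [ey oy]] := (Gx, Gy); split=> [|k].
    rewrite even_compM; apply: GD; first exact: GM.
    by rewrite (insert_vv Av); apply/Gsum => i; apply/GM => //; exact: Gov.
  rewrite odd_compM mulrDr !mulrA; apply: GD; last exact: GM.
  by rewrite (insert_vv Av); apply/Gsum => i; apply/GM => //; exact: Gv.
- move=> x Gx; have [ex ox] := Gx; split=> [|k].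
    by rewrite even_comp_star; exact: Gs.
  by rewrite odd_comp_star -(star_v Av k) -starM; apply/Gs/Gov.
- exact: even_lift_closed.
Qed.

(** The even lift contains the generators, hence everything, in particular the even element [Phi f].
    Generation of [A] thus replaces a density argument for polynomials in the [zz i j]. *)
Lemma v_Phi f i : v i * Phi f = Phi (bar f) * v i.
Proof.
have Gv x : even_lift Av (Phi @` half_commuting) x.
  apply: (sphere_generated Av); first exact: even_lift_subalgebra.
  move=> k; split=> [|l].
    rewrite (even_comp_odd (odd_v Av k)).
    have [G1 GL _ _ _] := half_commuting_subalgebra.
    by rewrite -(addNr 1) -scaleN1r; exact: GL.
  rewrite (odd_comp_id (odd_v Av k)) -Phi_zz; exists (zz l k) => // j.
  by rewrite cfun_conjP_zz !Phi_zz !mulrA; split; exact: (v_half Av).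
have [[g Gg gE] _] := Gv (Phi f).
move: gE; rewrite (even_comp_id (Phi_even f)) => /Phi_injective gf.
by rewrite -gf; exact: (Gg i).1.
Qed.

(** Expresses conjugation by two-sided multiplications, so every ideal of [A] has a conjugation
    stable even part. *)
Lemma Phi_conjP f : Phi (bar f) = \sum_i v i * Phi f * v i.
Proof.
under eq_bigr do rewrite v_Phi -mulrA.
by rewrite -mulr_sumr (sum_vv Av) mulr1.
Qed.

(** * From conjugation stable closed sets to graded ideals *)

Lemma vanishing_ideal_ideal Y : function_ideal (@vanishing_ideal C P Y).
Proof.
split=> [y _//|f g f0 g0 y Yy|f g g0 y Yy].
  by rewrite cfunDE f0 ?g0 ?addr0.
by rewrite cfunME g0 ?mulr0.
Qed.

Lemma vanishing_ideal_closed Y :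
  closed (Phi @` vanishing_ideal Y).
Proof.
apply: Phi_image_closed => f fY y Yy; apply/eqP; rewrite -normr_le0.
apply/ler_addgt0Pr => e /fY[g gY /(_ y)].
by rewrite gY// subr0 add0r.
Qed.

Lemma vanishing_ideal_lift Y : conj_stable Y ->
  closed_ideal (even_lift Av (Phi @` vanishing_ideal Y)).
Proof.
move=> Yconj; have [J0 JD JM] := vanishing_ideal_ideal Y.
apply: even_lift_ideal; last exact: vanishing_ideal_closed.
- by exists 0.
- by move=> _ _ [f Jf <-] [g Jg <-]; exists (f + g); [exact: JD|exact: PhiD].
- move=> _ _ /Phi_onto[f <-] [g Jg <-].
  by exists (f * g); [exact: JM|exact: PhiM].
- move=> _ _ [g Jg <-] /Phi_onto[f <-].
  by exists (f * g); [exact: JM|rewrite mulrC; exact: PhiM].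
(* By [v_Phi], [v k * Phi f * v l] is [Phi (bar f) * v k * v l]; conjugation stability of [Y] makes
   [bar f] vanish on [Y]. *)
- move=> _ k l [f Jf <-]; exists (zz k l * bar f).
    by apply: JM => y Yy; rewrite cfun_conjPE Jf//; apply: Yconj; exists y.
  by rewrite mulrC PhiM Phi_zz v_Phi mulrA.
Qed.

(** The even lift of the image of the vanishing ideal is a closed ideal containing that image and
    having no other even elements, so generating an ideal adds none. *)
Lemma ideal_gen_vanishing Y f : conj_stable Y ->
  ideal_gen (Phi @` vanishing_ideal Y) (Phi f) <-> vanishing_ideal Y f.
Proof.
move=> Yconj; split=> [If|Yf]; last by apply: sub_ideal_gen; exists f.
have sub : Phi @` vanishing_ideal Y `<=` even_lift Av (Phi @` vanishing_ideal Y).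
  move=> _ [g Yg <-]; split=> [|k].
    by rewrite (even_comp_id (Phi_even g)); exists g.
  by rewrite (odd_comp_even (Phi_even g)) mulr0; exists 0.
have := ideal_gen_sub (vanishing_ideal_lift Yconj) sub If.
by rewrite /even_lift/= (even_comp_id (Phi_even f)) => -[[g Yg /Phi_injective <-]].
Qed.

(** The generators are fixed by the sign automorphism, so the preimage of the ideal under it is a
    closed ideal containing them, hence contains the ideal. *)
Lemma ideal_gen_vanishing_graded Y : graded Av (ideal_gen (Phi @` vanishing_ideal Y)).
Proof.
set I := ideal_gen _; have cI : closed_ideal I := ideal_gen_closed_ideal _.
apply: graded_of_sign_stable => //.
apply: (@ideal_gen_sub _ _ _ (sign Av @^-1` I)); last first.
  move=> _ [f Yf <-]; rewrite /= [sign Av _]Phi_even.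
  by apply: sub_ideal_gen; exists f.
have [I0 ID IL IR Ic] := cI; split=> /=.
- by rewrite rmorph0.
- by move=> x y Ix Iy; rewrite rmorphD; exact: ID.
- by move=> a x Ix; rewrite rmorphM; exact: IL.
- by move=> a x Ix; rewrite rmorphM; exact: IR.
- by apply: closed_comp => // x _; exact: sign_continuous.
Qed.

Lemma cproj_separation Y p : closed Y -> ~ Y p ->
  exists2 f : CP, vanishing_ideal Y f & f p != 0.
Proof.
move=> cY Yp; apply: cfun_separation => //; first exact: compact_cproj.
move=> q qp; apply: contrapT => /forallNP sep; move: qp; apply/negP/negPn/eqP.
by apply: zz_separation => i j; have /negP/negPn/eqP := sep (zz i j).
Qed.

(** * Recovering a graded ideal from its zero set *)

Section Surjectivity.
Variables (I : set A) (cI : closed_ideal I) (gI : graded Av I).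
Let J : set CP := [set f | I (Phi f)].
Let zeros : set P := [set p | forall f, J f -> f p = 0].

Lemma zeros_closed : closed zeros.
Proof.
rewrite (_ : zeros = \bigcap_(f in J) (fun x => f x) @^-1` [set 0]); last first.
  by apply/seteqP; split=> p zp f Jf; exact: zp.
apply: closed_bigI => f _; apply: closed_comp; first by move=> x _; exact: cts_fun.
exact: accessible_closed_set1 (hausdorff_accessible (@norm_hausdorff _ C)) _.
Qed.

(** The value of [f] at the conjugate of [p] is that of [bar f] at [p], and [Phi_conjP] puts [bar f]
    in [J]. *)
Lemma zeros_conj : conj_stable zeros.
Proof.
move=> _ [p zp <-] f Jf; rewrite -cfun_conjPE; apply: zp.
have [_ _ IL IR _] := cI.
rewrite /J/= Phi_conjP; apply: closed_ideal_sum => // i.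
by apply: IR; exact: IL.
Qed.

Lemma vanishing_ideal_zeros : vanishing_ideal zeros = J.
Proof.
have [I0 ID IL IR /closedP_dist Ic] := cI.
apply/seteqP; split=> [h hz|f Jf y yz]; last exact: yz.
apply: closed_ideal_zeros => //; first exact: compact_cproj.
- split=> [|f g Jf Jg|f g Jg]; rewrite /J/= ?Phi0 ?PhiD ?PhiM//; first exact: ID.
  exact: IL.
- move=> f Jf; apply: Ic => e e0; have e2 : 0 < e / 2 by rewrite divr_gt0.
  have [g Jg fg] := Jf _ e2; exists (Phi g) => //.
  rewrite -PhiB (@le_lt_trans _ _ (e / 2))//; first exact: Phi_le.
  by rewrite ltr_pdivrMr// ltr_pMr// ltr1n.
Qed.

Lemma ideal_gen_zeros : ideal_gen (Phi @` vanishing_ideal zeros) = I.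
Proof.
rewrite vanishing_ideal_zeros; have [I0 ID IL IR _] := cI.
apply/seteqP; split; first by apply: ideal_gen_sub => // _ [f Jf <-].
set K := ideal_gen _; have cK : closed_ideal K := ideal_gen_closed_ideal _.
have evenK x : I x -> even_part Av x -> K x.
  by move=> Ix /Phi_onto[f fx]; apply: sub_ideal_gen; exists f; rewrite /J/= ?fx.
have [K0 KD KL _ _] := cK.
rewrite gI.1 => _ [x [Ix xe] [y [Iy yo] <-]]; apply: KD; first exact: evenK.
(* The odd [y] is the sum of the [v i * (v i * y)], where [v i * y] is even and in [I], hence in
   [K]. *)
rewrite -[y]mul1r -(sum_vv Av) mulr_suml; apply: closed_ideal_sum => // i.
rewrite -mulrA; apply: KL; apply: evenK; first exact: IL.
by apply: odd_oddM => //; exact: odd_v.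
Qed.

End Surjectivity.

End EvenPartIso.

Theorem corollary3p9 (R : realType) (n : nat)
  (A : cstarAlgType (complexF R))
  (v : 'I_n.+1 -> A) (Av : is_half_liberated_sphere v)
  (Phi : {lrmorphism continuousType (cproj (complexF R) n.+1) (complexF R) -> A})
  (hPhi : is_even_part_iso Av Phi) :
  set_bij [set Y : set (cproj (complexF R) n.+1) | closed Y /\ conj_stable Y]
          [set I : set A | closed_ideal I /\ graded Av I]
          (fun Y => ideal_gen (Phi @` vanishing_ideal Y)).
Proof.
split.
- move=> Y [cY Yconj]; split; first exact: ideal_gen_closed_ideal.
  exact: ideal_gen_vanishing_graded.
(* A function vanishing on [Y] but not at some [p] of [Z] would, by equality of the generated
   ideals, vanish on [Z]. *)
- have sub Y Z : closed Y -> conj_stable Y -> conj_stable Z ->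
      ideal_gen (Phi @` vanishing_ideal Y) = ideal_gen (Phi @` vanishing_ideal Z) ->
      Z `<=` Y.
    move=> cY Yconj Zconj YZ p Zp; apply: contrapT => Yp.
    have [f Yf /eqP[]] := cproj_separation cY Yp.
    have : vanishing_ideal Z f by apply/(ideal_gen_vanishing hPhi) => //; rewrite -YZ;
      apply/(ideal_gen_vanishing hPhi).
    exact.
  move=> Y Z /set_mem[cY Yconj] /set_mem[cZ Zconj] YZ.
  by apply/seteqP; split; apply: sub.
- move=> I [cI gI]; eexists; last exact: (ideal_gen_zeros hPhi cI gI).
  by split; [exact: zeros_closed|exact: (zeros_conj hPhi)].
Qed.
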